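(* Let $p\in\mathbb Z_{>0}$ be even and $r\in\mathbb C$. Then $$u_{p,r}=\Biggl(S_p\Bigl(-\tfrac{\alpha}{c_{L,\alpha}}\Bigr)+\sum_{k=0}^{\frac{p-1}2}\frac1{k+\frac12}\Bigl(\sum_{i\ge0}\Psi\bigl(i+k-\tfrac{p-1}2\bigr)S_i\bigl(-\tfrac{\alpha}{2c_{L,\alpha}}\bigr)\Bigr)\Bigl(\sum_{j\ge0}\Psi\bigl(j-k-\tfrac{p+1}2\bigr)S_j\bigl(-\tfrac{\alpha}{2c_{L,\alpha}}\bigr)\Bigr)\Biggr)v_{p,r}$$ (the sum over $k$ running over the integers $k$ with $0\le k\le\frac{p-1}2$) is a singular vector, of conformal weight $h_{p,r}+p=h_{p,r-1}$, in $V[p,r]=\mathcal F_{p,r}$.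
   Context: The $N=1$ Heisenberg-Virasoro algebra $\mathcal{SH}$ is the complex Lie superalgebra with even basis elements $L(n),\alpha(n)$ ($n\in\mathbb Z$), odd basis elements $G(n+\frac12),\Psi(n+\frac12)$ ($n\in\mathbb Z$), and even central elements $C_L,C_\alpha,C_{L,\alpha}$, with (super)commutators, for $m,n\in\mathbb Z$: $[\alpha(m),\alpha(n)]=\delta_{m+n,0}\,m\,C_\alpha$; $[L(m),\alpha(n)]=-n\,\alpha(m+n)-\delta_{m+n,0}(m^2+m)C_{L,\alpha}$; $[L(m),L(n)]=(m-n)L(m+n)+\delta_{m+n,0}\frac{m^3-m}{12}C_L$; $[\Psi(m+\frac12),\Psi(n+\frac12)]_+=\delta_{m+n+1,0}C_\alpha$; $[\alpha(m),\Psi(n+\frac12)]=0$; $[G(m+\frac12),G(n+\frac12)]_+=2L(m+n+1)+\delta_{m+n+1,0}\frac{m^2+m}{3}C_L$; $[L(m),G(n+\frac12)]=(\frac m2-n-\frac12)G(m+n+\frac12)$; $[\alpha(m),G(n+\frac12)]=m\,\Psi(m+n+\frac12)$; $[\Psi(m+\frac12),L(n)]=\frac{2m+n+1}{2}\Psi(m+n+\frac12)$; $[\Psi(m+\frac12),G(n+\frac12)]_+=\alpha(m+n+1)+2m\,\delta_{m+n+1,0}C_{L,\alpha}$. Let $\mathcal{SH}^{+}$ be the span of $L(n),\alpha(n),G(n-\frac12),\Psi(n-\frac12)$, $n\ge1$. A singular vector is a nonzero vector annihilated by $\mathcal{SH}^+$. Fix $c_L,c_{L,\alpha}\in\mathbb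 C$ with $c_{L,\alpha}\ne0$. For $h,h_\alpha\in\mathbb C$, $V(h,h_\alpha)$ denotes the Verma module: the universal $\mathcal{SH}$-module generated by a vector $v$ with $\mathcal{SH}^+v=0$, $L(0)v=hv$, $\alpha(0)v=h_\alpha v$, on which $C_L,C_\alpha,C_{L,\alpha}$ act by $c_L,0,c_{L,\alpha}$. For $p,r\in\mathbb C$ put $h_{p,r}=(1-p^2)\frac{c_L-3}{24}-rp$ and $V[p,r]=V(h_{p,r},(1+p)c_{L,\alpha})$, with highest weight vector $v_{p,r}$. Conformal weight means $L(0)$-eigenvalue. For $p\notin\mathbb Z_{<0}$, $V[p,r]$ is identified with the Fock module $\mathcal F_{p,r}$ (to which it is isomorphic): the module over the Heisenberg algebra ($c(n),d(n)$; $\langle c,c\rangle=\langle d,d\rangle=0,\langle c,d\rangle=2$) and the fermions ($\Psi^\pm(s)$, $s\in\frac12+\mathbb Z$; $\{\Psi^+(s),\Psi^-(s')\}=\delta_{s+s',0}$, other anticommutators zero) generated by the vacuum $v_{p,r}=e^{-\frac{p+1}2\overline d+rc}$, $\overline d=d-\frac{c_L-3}{12}c$, with $\alpha(n)=-c_{L,\alpha}c(n)$, $\Psi(s)=-\sqrt2c_{L,\alpha}\Psi^-(s)$, and $L(z)$, $G(z)$ the fields of the vectors $\omega=\frac12c(-1)d(-1)+\frac{c_L-3}{24}c(-2)-\frac12d(-2)+\frac12\Psi^+(-\frac32)\Psi^-(-\frac12)+\frac12\Psi^-(-\frac32)\Psi^+(-\frac12)$ and $\tau=\sqrt2(\frac12c(-1)\Psi^+(-\frac12)+\frac12d(-1)\Psi^-(-\frac12)+\frac{c_L-3}{12}\Psi^-(-\frac32)-\Psi^+(-\frac32))$.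 Schur polynomials: $S_k(\beta)=S_k(\beta(-1),\beta(-2),\dots)$ are defined by $\exp\left(\sum_{n\ge1}\beta(-n)\frac{z^n}{n}\right)=\sum_{k\ge0}S_k(\beta)z^k$; $S_k(-\frac{\alpha}{tc_{L,\alpha}})$, $t=1,2$, is obtained by substituting $\beta(-n)=-\frac{1}{tc_{L,\alpha}}\alpha(-n)$. The sums over $i,j$ are finite on $v_{p,r}$ because $\Psi(s)v_{p,r}=0$ for $s>0$ and the operators $\Psi(s)$, $\alpha(n)$ mutually (anti)commute at level zero.
   Formalization: The sum over k carries an extra factor 1/(2c_{L,α}^2), as if Ψ were read as Ψ^-; without it the displayed vector is not singular unless 2c_{L,α}^2=1 (for p=2, G(3/2)u=(2c_{L,α}-1/c_{L,α})Ψ(-1/2)v). *)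

(* Defs.v *)
From mathcomp Require Import all_boot all_order all_algebra.
From mathcomp Require Import complex.
From mathcomp Require Import boolp classical_sets fsbigop reals.

Set Implicit Arguments.
Unset Strict Implicit.
Unset Printing Implicit Defensive.

Import Order.TTheory GRing.Theory Num.Theory.
Local Open Scope classical_set_scope.
Local Open Scope ring_scope.

(* Half-integer modes are indexed by their integer part: [shG m], [shPsi m],
   [opsip m], [opsim m] stand for G(m+1/2), Psi(m+1/2), Psi^+(m+1/2),
   Psi^-(m+1/2). *)

Inductive sh_basis : Type :=
  | shL of int | shA of int | shG of int | shPsi of int
  | shCL | shCA | shCLA.

Definition sh_odd (x : sh_basis) : bool :=
  match x with shG _ | shPsi _ => true | _ => false end.

(* A linear combination of basis elements is given by its list of terms. *)
Definition sh_bracket (K : fieldType) (x y : sh_basis) : seq (K * sh_basis) :=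
  let z (k : int) : K := k%:~R in
  let delta (k : int) : K := (k == 0)%:R in
  match x, y with
  | shA m, shA n => [:: (delta (m + n) * z m, shCA)]
  | shL m, shA n =>
      [:: (- z n, shA (m + n)); (- (delta (m + n) * z (m ^+ 2 + m)), shCLA)]
  | shA n, shL m =>
      [:: (z n, shA (m + n)); (delta (m + n) * z (m ^+ 2 + m), shCLA)]
  | shL m, shL n =>
      [:: (z (m - n), shL (m + n));
          (delta (m + n) * (z (m ^+ 3 - m) / 12), shCL)]
  | shPsi m, shPsi n => [:: (delta (m + n + 1), shCA)]
  | shG m, shG n =>
      [:: (2, shL (m + n + 1));
          (delta (m + n + 1) * (z (m ^+ 2 + m) / 3), shCL)]
  | shL m, shG n => [:: (z m / 2 - z n - 1 / 2, shG (m + n))]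
  | shG n, shL m => [:: (- (z m / 2 - z n - 1 / 2), shG (m + n))]
  | shA m, shG n => [:: (z m, shPsi (m + n))]
  | shG n, shA m => [:: (- z m, shPsi (m + n))]
  | shPsi m, shL n => [:: (z (2 * m + n + 1) / 2, shPsi (m + n))]
  | shL n, shPsi m => [:: (- (z (2 * m + n + 1) / 2), shPsi (m + n))]
  | shPsi m, shG n | shG n, shPsi m =>
      [:: (1, shA (m + n + 1)); (z (2 * m) * delta (m + n + 1), shCLA)]
  | _, _ => [::]
  end.

Definition is_linear_map (K : fieldType) (M N : lmodType K) (f : M -> N) :=
  forall (a : K) (u w : M), f (a *: u + w) = a *: f u + f w.

Definition is_sh_module (K : fieldType) (M : lmodType K)
    (rho : sh_basis -> M -> M) : Prop :=
  (forall x, is_linear_map (rho x)) /\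
  (forall x y w,
     rho x (rho y w) - (-1) ^+ (sh_odd x && sh_odd y) *: rho y (rho x w)
     = \sum_(t <- sh_bracket K x y) t.1 *: rho t.2 w).

(* The basis elements spanning SH^+. *)
Definition sh_pos (x : sh_basis) : bool :=
  match x with
  | shL n | shA n => 0 < n
  | shG m | shPsi m => 0 <= m
  | shCL | shCA | shCLA => false
  end.

Definition singular (K : fieldType) (M : lmodType K)
    (rho : sh_basis -> M -> M) (w : M) : Prop :=
  w <> 0 /\ forall x, sh_pos x -> rho x w = 0.

Definition conformal_weight (K : fieldType) (M : lmodType K)
    (rho : sh_basis -> M -> M) (h : K) (w : M) : Prop :=
  rho (shL 0) w = h *: w.

Definition generated_by (K : fieldType) (X : Type) (M : lmodType K)
    (rho : X -> M -> M) (v : M) : Prop :=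
  forall P : set M,
    P v -> P 0 ->
    (forall (a : K) (u w : M), P u -> P w -> P (a *: u + w)) ->
    (forall x w, P w -> P (rho x w)) ->
    forall w, P w.

(* v = 0 is allowed, as it must be in the universal property below. *)
Definition hw_conditions (K : fieldType) (cL cLa h ha : K)
    (M : lmodType K) (rho : sh_basis -> M -> M) (v : M) : Prop :=
  [/\ is_sh_module rho,
      [/\ forall w, rho shCL w = cL *: w,
          forall w, rho shCA w = 0 &
          forall w, rho shCLA w = cLa *: w],
      forall x, sh_pos x -> rho x v = 0,
      rho (shL 0) v = h *: v &
      rho (shA 0) v = ha *: v].

(* (M, v) is the Verma module V(h, ha) with its highest weight vector.  The
   morphism f is unique because v generates M. *)
Definition is_verma (K : fieldType) (cL cLa h ha : K)
    (M : lmodType K) (rho : sh_basis -> M -> M) (v : M) : Prop :=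
  [/\ hw_conditions cL cLa h ha rho v,
      generated_by rho v &
      forall (N : lmodType K) (sigma : sh_basis -> N -> N) (w : N),
        hw_conditions cL cLa h ha sigma w ->
        exists f : M -> N,
          [/\ is_linear_map f,
              forall x u, f (rho x u) = sigma x (f u) &
              f v = w]].

Definition h_pr (K : fieldType) (cL p r : K) : K :=
  (1 - p ^+ 2) * ((cL - 3) / 24) - r * p.

Definition is_verma_pr (K : fieldType) (cL cLa p r : K) :=
  @is_verma K cL cLa (h_pr cL p r) ((1 + p) * cLa).

Inductive osc : Type :=
  | oc of int | od of int | opsip of int | opsim of int.

Definition osc_odd (x : osc) : bool :=
  match x with opsip _ | opsim _ => true | _ => false end.

Definition osc_mode (x : osc) : int :=
  match x with oc n | od n | opsip n | opsim n => n end.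

(* The pair (x.1, x.2) stands for x.1 c + x.2 d. *)
Definition heis_form (K : fieldType) (x y : K * K) : K :=
  2 * (x.1 * y.2 + x.2 * y.1).

Definition osc_bracket (K : fieldType) (x y : osc) : K :=
  match x, y with
  | oc m, od n | od m, oc n =>
      m%:~R * heis_form (1, 0) (0, 1) * (m + n == 0)%:R
  | opsip m, opsim n | opsim m, opsip n => (m + n + 1 == 0)%:R
  | _, _ => 0
  end.

(* -(p+1)/2 dbar + r c, where dbar = d - (cL-3)/12 c. *)
Definition fock_weight (K : fieldType) (cL p r : K) : K * K :=
  ((p + 1) / 2 * ((cL - 3) / 12) + r, - ((p + 1) / 2)).

(* These conditions determine (F, v) up to unique isomorphism: a nonzero
   module over the oscillators generated by a vacuum vector is irreducible. *)
Definition is_fock (K : fieldType) (cL p r : K)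
    (F : lmodType K) (o : osc -> F -> F) (v : F) : Prop :=
  [/\ (forall x, is_linear_map (o x)) /\
      (forall x y w,
         o x (o y w) - (-1) ^+ (osc_odd x && osc_odd y) *: o y (o x w)
         = osc_bracket K x y *: w),
      [/\ forall n, 0 < n -> o (oc n) v = 0,
          forall n, 0 < n -> o (od n) v = 0,
          forall m, 0 <= m -> o (opsip m) v = 0 &
          forall m, 0 <= m -> o (opsim m) v = 0],
      o (oc 0) v = heis_form (1, 0) (fock_weight cL p r) *: v /\
      o (od 0) v = heis_form (0, 1) (fock_weight cL p r) *: v,
      v <> 0 &
      generated_by o v].

(* Creation modes are those with n < 0, resp. s = m + 1/2 < 0. *)
Definition normal_order (K : fieldType) (F : lmodType K)
    (o : osc -> F -> F) (x y : osc) (w : F) : F :=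
  if osc_mode x < 0 then o x (o y w)
  else (-1) ^+ (osc_odd x && osc_odd y) *: o y (o x w).

(* L(n), G(m+1/2) are the coefficients of z^(-n-2), z^(-m-2) in the fields of
   omega and tau.  A factor a(-2) of such a vector contributes the derivative
   of a(z), whose modes are (-n-1) a(n); a factor Psi^+-(-3/2) contributes the
   derivative of Psi^+-(z), with modes (-s-1/2) Psi^+-(s) = -(m+1) Psi^+-(m+1/2).
   All but finitely many terms of each sum vanish on a given w in a Fock
   module. *)
Definition fock_L (K : fieldType) (cL : K) (F : lmodType K)
    (o : osc -> F -> F) (n : int) (w : F) : F :=
  2^-1 *: (\sum_(k \in [set: int]) normal_order o (oc k) (od (n - k)) w)
  + ((cL - 3) / 24 * (- n - 1)%:~R) *: o (oc n) w
  - (2^-1 * (- n - 1)%:~R) *: o (od n) w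
  + 2^-1 *: (\sum_(m \in [set: int])
       (- (m + 1))%:~R *: normal_order o (opsip m) (opsim (n - m - 1)) w)
  + 2^-1 *: (\sum_(m \in [set: int])
       (- (m + 1))%:~R *: normal_order o (opsim m) (opsip (n - m - 1)) w).

Definition fock_G (K : numClosedFieldType) (cL : K) (F : lmodType K)
    (o : osc -> F -> F) (m : int) (w : F) : F :=
  sqrtC 2 *:
   (2^-1 *: (\sum_(k \in [set: int]) normal_order o (oc k) (opsip (m - k)) w)
    + 2^-1 *: (\sum_(k \in [set: int]) normal_order o (od k) (opsim (m - k)) w)
    + ((cL - 3) / 12 * (- (m + 1))%:~R) *: o (opsim m) w
    - (- (m + 1))%:~R *: o (opsip m) w).

Definition fock_action (K : numClosedFieldType) (cL cLa : K)
    (F : lmodType K) (o : osc -> F -> F) (x : sh_basis) (w : F) : F :=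
  match x with
  | shL n => fock_L cL o n w
  | shA n => - cLa *: o (oc n) w
  | shG m => fock_G cL o m w
  | shPsi m => - (sqrtC 2 * cLa) *: o (opsim m) w
  | shCL => cL *: w
  | shCA => 0
  | shCLA => cLa *: w
  end.

(* Formal power series with operator coefficients. *)
Definition opser_one (M : nmodType) (k : nat) (w : M) : M :=
  if k == 0%N then w else 0.

Definition opser_mul (M : nmodType) (f g : nat -> M -> M) (k : nat) (w : M) : M :=
  \sum_(i < k.+1) f i (g (k - i)%N w).

(* exp f for a series f without constant term: f^m has no terms of degree
   less than m, so the coefficient of z^k stops at m = k. *)
Definition opser_exp (K : fieldType) (M : lmodType K)
    (f : nat -> M -> M) (k : nat) (w : M) : M :=
  \sum_(m < k.+1) (m`!%:R)^-1 *: iter m (opser_mul f) (@opser_one M) k w.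

(* S_k(beta), with [beta n] standing for beta(-n). *)
Definition schur (K : fieldType) (M : lmodType K)
    (beta : nat -> M -> M) (k : nat) : M -> M :=
  opser_exp (fun n w => if n == 0%N then 0 else n%:R^-1 *: beta n w) k.

(* S_k(- alpha / (t c_{L,alpha})) *)
Definition schur_alpha (K : fieldType) (cLa t : K) (M : lmodType K)
    (rho : sh_basis -> M -> M) (k : nat) : M -> M :=
  schur (fun n w => - (t * cLa)^-1 *: rho (shA (- n%:Z)) w) k.

(* sum_(i >= 0) Psi(i + m + 1/2) S_i(- alpha / (2 c_{L,alpha})) *)
Definition psi_schur (K : fieldType) (cLa : K) (M : lmodType K)
    (rho : sh_basis -> M -> M) (m : int) (w : M) : M :=
  \sum_(i \in [set: nat]) rho (shPsi (i%:Z + m)) (schur_alpha cLa 2 rho i w).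

(* For p even, k - (p-1)/2 = (k - p/2) + 1/2 and
   - k - (p+1)/2 = (- k - p/2 - 1) + 1/2, and k <= (p-1)/2 means k < p/2.

   The factor (2 cLa^2)^-1 is forced by the normalisation of Psi: the
   substitution alpha, Psi, C_{L,alpha} -> t alpha, t Psi, t C_{L,alpha} (with
   C_alpha -> t^2 C_alpha) is an automorphism that fixes S_p(-alpha/cLa) and
   scales Psi Psi by t^2.  Since Psi(s) = - sqrt 2 cLa Psi^-(s) in the Fock
   module, the fermionic term below is the usual
     sum_k (k+1/2)^-1 (sum_i Psi^-(..) S_i) (sum_j Psi^-(..) S_j);
   with Psi in place of Psi^-, and no factor, the vector is not annihilated by
   G(1/2) unless 2 cLa^2 = 1, already for p = 2. *)
Definition u_pr (K : fieldType) (cLa : K) (M : lmodType K)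
    (rho : sh_basis -> M -> M) (p : nat) (v : M) : M :=
  schur_alpha cLa 1 rho p v
  + \sum_(k < p./2)
      (k%:R + 1 / 2)^-1 *: ((2 * cLa ^+ 2)^-1 *:
        psi_schur cLa rho (k%:Z - p./2%:Z)
          (psi_schur cLa rho (- k%:Z - p./2%:Z - 1) v)).

(* Main.v *)
From HB Require Import structures.
Require Import Defs.
From mathcomp Require Import all_boot all_order all_algebra.
From mathcomp Require Import complex.
From mathcomp Require Import boolp classical_sets functions fsbigop reals.
From mathcomp Require Import finmap zify ring.

Set Implicit Arguments.
Unset Strict Implicit.
Unset Printing Implicit Defensive.

Import Order.TTheory GRing.Theory Num.Theory.
Local Open Scope ring_scope.

(** The vector u is singular because its two parts have opposite images under every
    G(n+1/2), n >= 0.  Put b_k = - alpha(-k)/c_{L,alpha} and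
    E(z) = exp (sum_{k >= 1} b_k z^k/k), so that S_k(- alpha/(t c_{L,alpha})) is
    the coefficient of z^k in E(z)^{1/t}; write e(z) = E(z)^{1/2} and let
    y(z) = Psi(z) e(z) with Psi(z) = sum_m Psi(m+1/2) z^{-m-1}.  Then u is
    S_p v plus a sum of multiples of y_i y_j v with i + j = p - 1.

    At level zero the alpha(n) and Psi(s) supercommute, so on the vectors that
    they generate from v the modes Psi(s), s > 0, and alpha(n), n > 0, vanish, and
    alpha(0) is the scalar (1 + p) c_{L,alpha}.  On such vectors G(n+1/2) acts as
    an odd derivation: it sends E(z) to - c_{L,alpha}^{-1} z^{n+1} Psi(z) E(z), and
    [dressed_psi_G] says that it sends y_j to
      - c_{L,alpha} (2 j + 1 - p) e_{j-n}.
    Indeed the quadratic terms in Psi cancel by antisymmetry, the terms in alpha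
    add up to the derivative of e, and the eigenvalue of alpha(0) together with
    the central term supplies the constant.  When i + j = p - 1 the factor
    2 j + 1 - p is j - i, which cancels the denominators k + 1/2 = (j - i)/2 of u,
    and the image of the fermionic part is the coefficient of z^{p-1-n} in
    c_{L,alpha}^{-1} e(z) y(z) v.  As e^2 = E ([schur_int_square]), this is the
    coefficient in c_{L,alpha}^{-1} Psi(z) E(z) v, opposite to the image of
    S_p v.  The modes L(n), n > 0, are anticommutators of G(1/2) with G(n-1/2),
    and alpha(n), Psi(s) raise no question.

    This argument needs the relations of SH and the highest weight conditions
    only, so it covers both modules once the Fock module is known to satisfy
    them ([fock_highest_weight]).  The brackets of the quadratic fields L and G
    with the oscillators are immediate.  For a relation among L and G, let D be
    the difference of its two sides.  The Jacobi identity shows that D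
    supercommutes with all oscillators, hence D = 0 as soon as D v = 0.  Now D v
    satisfies the same conditions as v, so that L(0) acts on it as on v; but D
    changes the L(0)-eigenvalue by its degree.  Hence D v = 0 when the degree is
    not zero ([graded_commutant_eq0]).  This leaves {G(s), G(-s)}, which is
    evaluated on v ([GG_v]); the relation for [L, L] follows from the others.

    In the Fock module u is not zero because d(p) maps it to 2 v: the mode c(-p)
    occurs in S_p v only, as c(-p)/p.  In the Verma module the positive modes
    of SH annihilate u and cannot detect it, so u is mapped to the Fock module by the
    universal property.  This requires a Fock module to exist
    ([fock_exists]); it is found inside the functions on the set of occupation
    numbers, as the submodule generated by the indicator of the empty state. *)

(** * Linear maps and linear combinations *)

Definition lin_of (K : fieldType) (M N : lmodType K) (f : M -> N)
    (lf : is_linear_map f) : {linear M -> N} :=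
  HB.pack f (GRing.isLinear.Build K M N _ f lf).
Arguments lin_of : simpl never.

Lemma linear_is_linear_map (K : fieldType) (M N : lmodType K)
  (f : {linear M -> N}) : is_linear_map f.
Proof. by move=> a u w; rewrite linearP. Qed.

(** The generic rewriting lemmas for linear maps also match the map [a *: _]; naming
    the map [T] as an argument keeps them from doing so. *)
Lemma linZ (K : fieldType) (M N : lmodType K) (T : {linear M -> N}) a u :
  T (a *: u) = a *: T u.
Proof. exact: linearZ_LR. Qed.

Lemma linD (K : fieldType) (M N : lmodType K) (T : {linear M -> N}) u w :
  T (u + w) = T u + T w.
Proof. exact: linearD. Qed.

Lemma linP (K : fieldType) (M N : lmodType K) (T : {linear M -> N}) a u w :
  T (a *: u + w) = a *: T u + T w.
Proof. exact: linearP. Qed.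

Lemma linN (K : fieldType) (M N : lmodType K) (T : {linear M -> N}) u :
  T (- u) = - T u.
Proof. exact: linearN. Qed.

Lemma lin_sum (K : fieldType) (M N : lmodType K) (T : {linear M -> N})
    (I : Type) (r : seq I) (Q : pred I) (F : I -> M) :
  T (\sum_(i <- r | Q i) F i) = \sum_(i <- r | Q i) T (F i).
Proof. exact: linear_sum. Qed.

(** An identity between linear combinations of vectors holds as soon as the
    coefficients of each vector agree.  The tactic [lincomb] reifies both sides of
    an equation over the list of the vectors that occur in it and leaves one
    scalar equation per vector to [ring] or [field]. *)
Section LinearCombinations.
Variables (K : fieldType) (M : lmodType K).

Inductive lexpr : Type :=
  | LAtom of nat | LZero | LAdd of lexpr & lexpr | LOpp of lexpr
  | LScale of K & lexpr | LMuln of lexpr & nat.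

Fixpoint leval (env : seq M) (e : lexpr) : M :=
  match e with
  | LAtom i => nth 0 env i
  | LZero => 0
  | LAdd e1 e2 => leval env e1 + leval env e2
  | LOpp e1 => - leval env e1
  | LScale a e1 => a *: leval env e1
  | LMuln e1 n => leval env e1 *+ n
  end.

Fixpoint lcoef (i : nat) (e : lexpr) : K :=
  match e with
  | LAtom j => if (j == i)%N then 1 else 0
  | LZero => 0
  | LAdd e1 e2 => lcoef i e1 + lcoef i e2
  | LOpp e1 => - lcoef i e1
  | LScale a e1 => a * lcoef i e1
  | LMuln e1 n => lcoef i e1 *+ n
  end.

Lemma leval_coef env e :
  leval env e = \sum_(i < size env) lcoef i e *: nth 0 env i.
Proof.
elim: e => [j||e1 IH1 e2 IH2|e1 IH1|a e1 IH1|e1 IH1 n] /=.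
- case: (ltnP j (size env)) => hj.
    rewrite (bigD1 (Ordinal hj)) //= eqxx scale1r big1 ?addr0 // => i.
    by rewrite -val_eqE /= eq_sym => /negPf ->; rewrite scale0r.
  rewrite nth_default // big1 // => i _.
  by rewrite ifN ?scale0r //; apply/eqP => ji; have := ltn_ord i; rewrite -ji ltnNge hj.
- by rewrite big1 // => i _; rewrite scale0r.
- by rewrite IH1 IH2 -big_split; apply: eq_bigr => i _; rewrite scalerDl.
- by rewrite IH1 -sumrN; apply: eq_bigr => i _; rewrite scaleNr.
- by rewrite IH1 scaler_sumr; apply: eq_bigr => i _; rewrite scalerA.
- by rewrite IH1 -sumrMnl; apply: eq_bigr => i _; rewrite scalerMnl.
Qed.

Fixpoint all_below (P : nat -> Prop) (n : nat) : Prop :=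
  if n is n1.+1 then all_below P n1 /\ P n1 else True.

Lemma leval_eq env e1 e2 :
  all_below (fun i => lcoef i e1 = lcoef i e2) (size env) ->
  leval env e1 = leval env e2.
Proof.
move=> H; rewrite !leval_coef; apply: eq_bigr => i _; congr (_ *: _).
move: (nat_of_ord i) (ltn_ord i) => j; elim: (size env) H => // n IH /= [/IH H1 H2].
by rewrite ltnS leq_eqVlt => /orP [/eqP -> | /H1].
Qed.

End LinearCombinations.

(* Occurrences of one vector may differ by the paths through the algebraic
   hierarchy along which they are typed; hence the fallback to unification. *)
Ltac lindex x l :=
  lazymatch l with
  | nil => fail
  | cons ?y ?l' =>
      match constr:(Set) with
      | _ =>
          let _ := match constr:(Set) with
                   | _ => first [constr_eq x y | unify x y] end in
          constr:(0%N)
      | _ => let i := lindex x l' in constr:(S i)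
      end
  end.

Ltac ladd x l :=
  match constr:(Set) with
  | _ => let _ := lindex x l in l
  | _ => constr:(cons x l)
  end.

Ltac latoms e l :=
  lazymatch e with
  | GRing.zero => l
  | GRing.add ?a ?b => let l1 := latoms a l in latoms b l1
  | GRing.opp ?a => latoms a l
  | GRing.scale _ ?a => latoms a l
  | GRing.natmul ?a _ => latoms a l
  | _ => ladd e l
  end.

Ltac lreify K e l :=
  lazymatch e with
  | GRing.zero => constr:(@LZero K)
  | GRing.add ?a ?b =>
      let a1 := lreify K a l in let b1 := lreify K b l in constr:(@LAdd K a1 b1)
  | GRing.opp ?a => let a1 := lreify K a l in constr:(@LOpp K a1)
  | GRing.scale ?k ?a => let a1 := lreify K a l in constr:(@LScale K k a1)
  | GRing.natmul ?a ?n => let a1 := lreify K a l in constr:(@LMuln K a1 n)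
  | _ => let i := lindex e l in constr:(@LAtom K i)
  end.

Ltac reify_lincomb :=
  lazymatch goal with
  | |- @eq ?T ?a ?b =>
      let T := eval simpl in T in
      let M := lazymatch T with GRing.Lmodule.sort ?M => M end in
      let K := lazymatch T with @GRing.Lmodule.sort ?K _ => K end in
      let l := latoms a (@nil T) in
      let l := latoms b l in
      let a1 := lreify K a l in
      let b1 := lreify K b l in
      apply: (@leval_eq _ M l a1 b1); cbn [size all_below lcoef eqn eq_op];
      rewrite /=; repeat split
  end.
Ltac lincomb := reify_lincomb; try by [ring | field].

(** * Exponentials of operator series *)

Lemma triangle_sum (V : nmodType) (k : nat) (F : nat -> nat -> V) :
  \sum_(i < k) \sum_(j < k - i) F i j = \sum_(j < k) \sum_(i < k - j) F i j.
Proof.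
have widen (G : nat -> nat -> V) : \sum_(i < k) \sum_(j < k - i) G i j =
    \sum_(i < k) \sum_(j < k) if (i + j < k)%N then G i j else 0.
  apply: eq_bigr => i _; rewrite (big_ord_widen k (G i)) ?leq_subr //.
  by rewrite big_mkcond; apply: eq_bigr => j _; rewrite ltn_subRL.
rewrite widen exchange_big (widen (fun j i => F i j)).
by apply: eq_bigr => j _; apply: eq_bigr => i _; rewrite addnC.
Qed.

Lemma triangle_sumS (V : nmodType) (k : nat) (F : nat -> nat -> V) :
  \sum_(i < k.+1) \sum_(j < (k - i).+1) F i j =
  \sum_(j < k.+1) \sum_(i < (k - j).+1) F i j.
Proof.
have ord_subS (i : 'I_k.+1) : (k - i).+1 = (k.+1 - i)%N.
  by rewrite subSn // -ltnS.
under eq_bigr do rewrite ord_subS.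
by rewrite triangle_sum; apply: eq_bigr => j _; rewrite ord_subS.
Qed.

Section OperatorSeries.
Variables (K : numFieldType) (M : lmodType K) (f : nat -> {linear M -> M}).

Local Notation fpow m := (iter m (opser_mul (fun i => f i : M -> M)) (@opser_one M)).

Lemma fpowS m k w : fpow m.+1 k w = \sum_(i < k.+1) f i (fpow m (k - i)%N w).
Proof. reflexivity. Qed.

Lemma fpow_linear m k : is_linear_map (fpow m k).
Proof.
elim: m k => [|m IH] k a u w.
  by rewrite /= /opser_one; case: ifP => // _; rewrite scaler0 addr0.
rewrite !fpowS scaler_sumr -big_split; apply: eq_bigr => i _.
by rewrite IH linearP.
Qed.

Lemma opser_exp_linear k : is_linear_map (opser_exp f k).
Proof.
move=> a u w; rewrite /opser_exp scaler_sumr -big_split.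
apply: eq_bigr => m _ /=; rewrite (fpow_linear m k a u w).
by rewrite scalerDr !scalerA mulrC.
Qed.

Definition opexp k : {linear M -> M} := lin_of (opser_exp_linear k).
Arguments opexp : simpl never.

Lemma opexpE k w : opexp k w = \sum_(m < k.+1) (m`!%:R)^-1 *: fpow m k w.
Proof. reflexivity. Qed.

Lemma fpow_intertwine (N : lmodType K) (g : nat -> {linear N -> N})
    (T : {linear M -> N}) :
  (forall i w, T (f i w) = g i (T w)) ->
  forall m k w, T (fpow m k w) = iter m (opser_mul g) (@opser_one N) k (T w).
Proof.
move=> Tf; elim=> [|m IH] k w.
  by rewrite /= /opser_one; case: ifP; rewrite ?linear0.
by rewrite fpowS linear_sum; apply: eq_bigr => i _; rewrite Tf IH.
Qed.

Lemma opser_exp_intertwine (N : lmodType K) (g : nat -> {linear N -> N})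
    (T : {linear M -> N}) :
  (forall i w, T (f i w) = g i (T w)) ->
  forall k w, T (opser_exp f k w) = opser_exp g k (T w).
Proof.
move=> Tf k w; rewrite /opser_exp linear_sum; apply: eq_bigr => m _.
by rewrite linearZ /= (fpow_intertwine Tf).
Qed.

Lemma opexp_commute (T : {linear M -> M}) :
  (forall i w, T (f i w) = f i (T w)) ->
  forall k w, T (opexp k w) = opexp k (T w).
Proof. exact: opser_exp_intertwine. Qed.

Lemma fpow_degree (D : {linear M -> M}) :
  (forall i w, D (f i w) = f i (D w) + i%:R *: f i w) ->
  forall m k w, D (fpow m k w) = fpow m k (D w) + k%:R *: fpow m k w.
Proof.
move=> Df; elim=> [|m IH] k w.
  rewrite /= /opser_one; case: eqP => [->|_]; first by rewrite scale0r addr0.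
  by rewrite linear0 scaler0 addr0.
rewrite !fpowS linear_sum scaler_sumr -big_split; apply: eq_bigr => i _ /=.
rewrite Df IH linearD linearZ /= natrB ?leq_ord //.
lincomb.
Qed.

Lemma opexp_degree (D : {linear M -> M}) :
  (forall i w, D (f i w) = f i (D w) + i%:R *: f i w) ->
  forall k w, D (opexp k w) = opexp k (D w) + k%:R *: opexp k w.
Proof.
move=> Df k w; rewrite !opexpE linear_sum scaler_sumr -big_split.
apply: eq_bigr => m _ /=; rewrite linearZ /= (fpow_degree Df); lincomb.
Qed.

(** The commutator with T is a derivation that sends f_i to g_i; since the g_i commute
    with the f_j, it acts on powers and on the exponential by the chain rule. *)
Section Bracket.
Variables (T : {linear M -> M}) (g : nat -> {linear M -> M}).
Hypothesis Tf : forall i w, T (f i w) = f i (T w) + g i w.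
Hypothesis gf : forall i j w, g i (f j w) = f j (g i w).

Lemma fpow_bracket m k w :
  T (fpow m.+1 k w) = fpow m.+1 k (T w)
    + m.+1%:R *: \sum_(i < k.+1) g i (fpow m (k - i)%N w).
Proof.
elim: m k w => [|m IH] k w.
  rewrite !(fpowS 0) linear_sum scale1r -big_split; apply: eq_bigr => i _.
  rewrite Tf; congr (f i _ + _).
  by rewrite /= /opser_one; case: ifP; rewrite ?linear0.
rewrite !(fpowS m.+1) linear_sum.
have -> : m.+2%:R *: \sum_(i < k.+1) g i (fpow m.+1 (k - i)%N w) =
  \sum_(i < k.+1) (g i (fpow m.+1 (k - i)%N w)
     + m.+1%:R *: f i (\sum_(j < (k - i).+1) g j (fpow m (k - i - j)%N w))).
  rewrite big_split -[m.+2]add1n natrD scalerDl scale1r; congr (_ + _).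
  rewrite -scaler_sumr; congr (_ *: _).
  under [RHS]eq_bigr do rewrite linear_sum.
  rewrite (triangle_sumS k (fun i j => f i (g j (fpow m (k - i - j)%N w)))).
  apply: eq_bigr => j _; rewrite (fpowS m) linear_sum; apply: eq_bigr => i _.
  by rewrite gf subnAC.
rewrite -big_split; apply: eq_bigr => i _ /=.
by rewrite Tf IH linearD linearZ /= -addrA [g i _ + _]addrC addrA.
Qed.

(* Without constant term, the m-th power starts in degree m; therefore the
   truncation of the exponential series at the degree may be moved. *)
Hypothesis f0 : forall w, f 0 w = 0.
Hypothesis g0 : forall w, g 0 w = 0.

Lemma fpow_small m k w : (k < m)%N -> fpow m k w = 0.
Proof.
elim: m k => [|m IH] k // lt_km; rewrite fpowS big1 // => -[[|i] lt_ik] _ /=.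
  by rewrite f0.
by rewrite IH ?linear0 //; lia.
Qed.

Lemma opexp_widen n k w : (k < n)%N ->
  opexp k w = \sum_(m < n) (m`!%:R)^-1 *: fpow m k w.
Proof.
move=> lt_kn; rewrite opexpE.
rewrite (big_ord_widen n (fun m => (m`!%:R)^-1 *: fpow m k w) lt_kn) big_mkcond.
apply: eq_bigr => m _; case: ifP => // /negbT; rewrite -leqNgt => le_km.
by rewrite fpow_small ?scaler0.
Qed.

Lemma opexp_bracket k w :
  T (opexp k w) = opexp k (T w) + \sum_(i < k) g i.+1 (opexp (k - i.+1)%N w).
Proof.
rewrite (opexpE k w) (opexpE k (T w)) linear_sum !big_ord_recl -addrA; congr (_ + _).
  rewrite linearZ /= /opser_one; congr (_ *: _).
  by case: ifP; rewrite ?linear0.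
under eq_bigr do rewrite linearZ /= fpow_bracket scalerDr.
rewrite big_split /=; congr (_ + _).
under eq_bigr => m _.
  rewrite scalerA big_ord_recl g0 add0r.
  have -> : (bump 0 m)`!%:R^-1 * m.+1%:R = (m`!%:R)^-1 :> K.
    rewrite /bump add1n factS natrM invfM mulrAC mulVf ?mul1r //.
    by rewrite pnatr_eq0.
  rewrite scaler_sumr.
  over.
rewrite exchange_big; apply: eq_bigr => i _.
rewrite -[opser_exp _ _ w]/(opexp (k - i.+1)%N w).
rewrite (@opexp_widen k); last by have := ltn_ord i; lia.
by rewrite linear_sum; apply: eq_bigr => m _; rewrite linearZ.
Qed.

End Bracket.
End OperatorSeries.

(** * The vector u in a highest weight module *)

(** Coefficients of power series are indexed by integers and vanish at negative
    ones, so that products of series are sums over a fixed range, in which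
    shifting the index is harmless. *)
Lemma shift_sum (V : nmodType) (F : int -> V) (N a : nat) :
  (forall i : int, i < 0 -> F i = 0) ->
  (forall i : int, (N%:Z - a%:Z <= i)%R -> F i = 0) ->
  \sum_(j < N) F (j%:Z - a%:Z) = \sum_(j < N) F j%:Z.
Proof.
move=> Fneg; elim: a => [|a IH] Fbig; first by under eq_bigr do rewrite subr0.
rewrite -IH; last by move=> i le_i; apply: Fbig; lia.
case: N {IH} Fbig => [|N] Fbig; first by rewrite !big_ord0.
rewrite big_ord_recl big_ord_recr /= Fneg; last by lia.
rewrite add0r [F (N%:Z - a%:Z)]Fbig ?addr0; last by lia.
by apply: eq_bigr => j _; congr F; rewrite /bump /=; lia.
Qed.

Lemma fsum_nat (V : nmodType) (n : nat) (F : nat -> V) :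
  (forall i, (n <= i)%N -> F i = 0) ->
  \sum_(i \in [set: nat]%classic) F i = \sum_(i < n) F i.
Proof.
move=> F0; rewrite fsbig_ord; apply/esym/fsbig_widen => // i [_ /= ge_in].
by apply: F0; rewrite leqNgt; apply/negP.
Qed.

Section HighestWeight.
Variables (K : numFieldType) (cL cLa h : K) (p : nat).
Variables (M : lmodType K) (rho : sh_basis -> {linear M -> M}) (v : M).
Hypothesis cLa_neq0 : cLa != 0.
Hypothesis hw : hw_conditions cL cLa h ((1 + p%:R) * cLa) (fun x => rho x) v.

Local Notation A n := (rho (shA n)).
Local Notation P n := (rho (shPsi n)).
Local Notation G n := (rho (shG n)).
Local Notation L n := (rho (shL n)).

Lemma hw_bracket x y w :
  rho x (rho y w) = (-1) ^+ (sh_odd x && sh_odd y) *: rho y (rho x w)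
    + \sum_(t <- sh_bracket K x y) t.1 *: rho t.2 w.
Proof. by case: hw => [[_ rel] _ _ _ _]; rewrite -rel addrC subrK. Qed.

Lemma alpha_alpha m n w : A m (A n w) = A n (A m w).
Proof.
rewrite hw_bracket /= big_seq1 /= scale1r.
by case: hw => _ [_ -> _] _ _ _; rewrite scaler0 addr0.
Qed.

Lemma alpha_psi m n w : A m (P n w) = P n (A m w).
Proof. by rewrite hw_bracket /= big_nil scale1r addr0. Qed.

Lemma psi_psi m n w : P m (P n w) = - P n (P m w).
Proof.
rewrite hw_bracket /= big_seq1 /= expr1 scaleN1r.
by case: hw => _ [_ -> _] _ _ _; rewrite scaler0 addr0.
Qed.

Lemma G_alpha n m w : G n (A m w) = A m (G n w) - m%:~R *: P (m + n) w.
Proof. by rewrite hw_bracket /= big_seq1 /= scale1r scaleNr. Qed.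

Lemma G_psi n m w : G n (P m w) = - P m (G n w) + A (m + n + 1) w
  + ((2 * m)%:~R * (m + n + 1 == 0)%:R * cLa) *: w.
Proof.
rewrite hw_bracket /= big_cons big_seq1 /= expr1 scaleN1r scale1r addrA.
by case: hw => _ [_ _ ->] _ _ _; rewrite scalerA.
Qed.

Lemma L0_alpha m w : L 0 (A m w) = A m (L 0 w) - m%:~R *: A m w.
Proof.
rewrite hw_bracket /= big_cons big_seq1 /= scale1r scaleNr add0r.
by rewrite expr0n addr0 mulr0 oppr0 scale0r addr0.
Qed.

Lemma L0_psi m w : L 0 (P m w) = P m (L 0 w) - (m%:~R + 2^-1) *: P m w.
Proof.
rewrite hw_bracket /= big_seq1 /= scale1r !addr0; congr (_ + _).
rewrite -scaleNr; congr (_ *: _).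
by field.
Qed.

(** The vectors generated from v by the alpha(n) and Psi(s) have these properties,
    and no more is used about them. *)
Definition vacuum_like (w : M) : Prop :=
  [/\ forall n, 0 < n -> A n w = 0, forall m, 0 <= m -> P m w = 0 &
      A 0 w = ((1 + p%:R) * cLa) *: w].

Lemma vacuum_like_v : vacuum_like v.
Proof. by case: hw => _ _ pos _ A0; split=> // n n0; apply: pos. Qed.

Lemma vacuum_like_sum (I : Type) (r : seq I) (Q : pred I) (F : I -> M) :
  (forall i, vacuum_like (F i)) -> vacuum_like (\sum_(i <- r | Q i) F i).
Proof.
move=> FV; split=> [n n0|m m0|]; rewrite linear_sum.
- by rewrite big1 // => i _; case: (FV i) => FA _ _; apply: FA.
- by rewrite big1 // => i _; case: (FV i) => _ FP _; apply: FP.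
- by rewrite scaler_sumr; apply: eq_bigr => i _; case: (FV i).
Qed.

Lemma vacuum_likeZ a w : vacuum_like w -> vacuum_like (a *: w).
Proof.
case=> Aw Pw A0w; split=> [n n0|m m0|]; rewrite linearZ /=.
- by rewrite Aw ?scaler0.
- by rewrite Pw ?scaler0.
- by rewrite A0w !scalerA mulrC.
Qed.

Lemma vacuum_likeD u w : vacuum_like u -> vacuum_like w -> vacuum_like (u + w).
Proof.
case=> Au Pu A0u [Aw Pw A0w]; split=> [n n0|m m0|]; rewrite linearD.
- by rewrite Au ?Aw ?addr0.
- by rewrite Pu ?Pw ?addr0.
- by rewrite A0u A0w scalerDr.
Qed.

Lemma vacuum_likeP m w : vacuum_like w -> vacuum_like (P m w).
Proof.
case=> Aw Pw A0w; split=> [n n0|k k0|].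
- by rewrite alpha_psi Aw ?linear0.
- by rewrite psi_psi Pw ?linear0 ?oppr0.
- by rewrite alpha_psi A0w linearZ.
Qed.

Lemma vacuum_like_comm (T : {linear M -> M}) w :
  (forall n u, A n (T u) = T (A n u)) -> (forall m u, P m (T u) = T (P m u)) ->
  vacuum_like w -> vacuum_like (T w).
Proof.
move=> TA TP [Aw Pw A0w]; split=> [n n0|k k0|].
- by rewrite TA Aw ?linear0.
- by rewrite TP Pw ?linear0.
- by rewrite TA A0w linearZ.
Qed.

Section Schur.
Variable t : K.

Lemma schur_term_linear n : is_linear_map (fun w : M =>
  if n == 0%N then 0 else n%:R^-1 *: (- (t * cLa)^-1 *: A (- n%:Z) w)).
Proof.
move=> a u w; case: eqP => _; first by rewrite scaler0 addr0.
by rewrite linearP; lincomb.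
Qed.

Definition schur_term n := lin_of (schur_term_linear n).

Lemma schur_termE n w : schur_term n w =
  if n == 0%N then 0 else n%:R^-1 *: (- (t * cLa)^-1 *: A (- n%:Z) w).
Proof. by []. Qed.

Definition schur_op k : {linear M -> M} := opexp schur_term k.

Lemma schur_term_commute (T : {linear M -> M}) :
  (forall n w, T (A n w) = A n (T w)) ->
  forall n w, T (schur_term n w) = schur_term n (T w).
Proof.
move=> TA n w; rewrite !schur_termE; case: eqP => _; first by rewrite linear0.
by rewrite 2!(linZ T) /= TA.
Qed.

Lemma schur_op_commute (T : {linear M -> M}) :
  (forall n w, T (A n w) = A n (T w)) ->
  forall k w, T (schur_op k w) = schur_op k (T w).
Proof. by move=> TA; apply/opexp_commute/schur_term_commute. Qed.

(** The chain rule for the exponential, used with X(n) = alpha(n) for T = L(0), with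
    X(n) = Psi(n + m + 1/2) for T = G(m+1/2), and with a scalar X(n) for T = d(p). *)
Lemma schur_op_bracket (T : {linear M -> M}) (X : int -> {linear M -> M}) :
  (forall n w, T (A n w) = A n (T w) - n%:~R *: X n w) ->
  (forall m n w, X m (A n w) = A n (X m w)) ->
  forall k w, T (schur_op k w) = schur_op k (T w)
    + \sum_(i < k) - (t * cLa)^-1 *: X (- i.+1%:Z) (schur_op (k - i.+1)%N w).
Proof.
move=> TA XA k w.
pose g (i : nat) : {linear M -> M} :=
    - (if i == 0%N then 0 else (t * cLa)^-1) \*: X (- i%:Z).
have gf i j u : g i (schur_term j u) = schur_term j (g i u).
  by apply: schur_term_commute => n x /=; rewrite XA linZ.
rewrite /schur_op (@opexp_bracket _ _ schur_term T g) //.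
- move=> [|n] u; rewrite !schur_termE /g /=.
    by rewrite linear0 oppr0 scale0r addr0.
  rewrite 2!(linZ T) /= TA.
  have n0 : n.+1%:R != 0 :> K by rewrite pnatr_eq0.
  rewrite rmorphN /= -pmulrn; move: (n.+1%:R) n0 ((t * cLa)^-1) => N N0 c.
  by lincomb.
- by move=> u; rewrite /g /= oppr0 scale0r.
Qed.

Lemma schur_op_degree k w :
  L 0 (schur_op k w) = schur_op k (L 0 w) + k%:R *: schur_op k w.
Proof.
apply: opexp_degree => [[|n] u]; rewrite !schur_termE /=.
  by rewrite linear0 scale0r addr0.
rewrite 2!(linZ (L 0)) L0_alpha rmorphN /= -pmulrn.
by move: (n.+1%:R) => N; lincomb.
Qed.

(** Bracketing with L(0) also multiplies by the degree, whence Newton's recursion. *)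
Lemma schur_op_recursion k w :
  k%:R *: schur_op k w =
  \sum_(i < k) - (t * cLa)^-1 *: A (- i.+1%:Z) (schur_op (k - i.+1)%N w).
Proof.
apply: (addrI (schur_op k (L 0 w))); rewrite -schur_op_degree.
apply: (@schur_op_bracket (L 0) (fun n => rho (shA n))); first exact: L0_alpha.
by move=> m n u; apply: alpha_alpha.
Qed.

Lemma schur_op_G n k w :
  G n (schur_op k w) = schur_op k (G n w)
  + \sum_(i < k) - (t * cLa)^-1 *: P (n - i.+1%:Z) (schur_op (k - i.+1)%N w).
Proof.
rewrite (@schur_op_bracket (G n) (fun m => rho (shPsi (m + n)))).
- by congr (_ + _); apply: eq_bigr => i _; rewrite addrC.
- by move=> m u; apply: G_alpha.
- by move=> m l u; rewrite alpha_psi.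
Qed.

Definition schur_int (k : int) : {linear M -> M} :=
  if k is Posz n then schur_op n else \0.
Arguments schur_int : simpl never.

Lemma schur_int_neg k w : k < 0 -> schur_int k w = 0.
Proof. by case: k. Qed.

Lemma schur_int_commute (T : {linear M -> M}) :
  (forall n w, T (A n w) = A n (T w)) ->
  forall k w, T (schur_int k w) = schur_int k (T w).
Proof.
by move=> TA [k|k] w; [exact: schur_op_commute | rewrite !schur_int_neg // linear0].
Qed.

Lemma schur_int_alpha k n w : schur_int k (A n w) = A n (schur_int k w).
Proof. by symmetry; apply: schur_int_commute => m u; apply: alpha_alpha. Qed.

Lemma schur_int_psi k n w : schur_int k (P n w) = P n (schur_int k w).
Proof. by symmetry; apply: schur_int_commute => m u; rewrite alpha_psi. Qed.

Lemma vacuum_like_schur_int k w : vacuum_like w -> vacuum_like (schur_int k w).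
Proof.
by apply: vacuum_like_comm => n u; rewrite ?schur_int_alpha ?schur_int_psi.
Qed.

Lemma schur_int_degree k w :
  L 0 (schur_int k w) = schur_int k (L 0 w) + k%:~R *: schur_int k w.
Proof.
by case: k => k; [exact: schur_op_degree | rewrite !schur_int_neg // linear0 scaler0 addr0].
Qed.

Lemma widen_schur_int (X : nat -> {linear M -> M}) (k : nat) N w : (k <= N)%N ->
  \sum_(i < k) X i (schur_op (k - i.+1)%N w) =
  \sum_(i < N) X i (schur_int (k%:Z - i.+1%:Z) w).
Proof.
move=> le_kN; rewrite (big_ord_widen N (fun i => X i (schur_op (k - i.+1) w))) //.
rewrite big_mkcond; apply: eq_bigr => i _; case: ifP => lt_ik.
  by rewrite subzn.
by rewrite schur_int_neg ?linear0 //; lia.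
Qed.

Lemma schur_int_recursion k N w : k <= N%:Z ->
  k%:~R *: schur_int k w =
  - (t * cLa)^-1 *: \sum_(i < N) A (- i.+1%:Z) (schur_int (k - i.+1%:Z) w).
Proof.
case: k => k le_kN; last first.
  rewrite schur_int_neg // scaler0 big1 ?scaler0 // => i _.
  by rewrite ?schur_int_neg ?linear0 //; lia.
rewrite [LHS]schur_op_recursion -scaler_sumr; congr (_ *: _).
by apply: (widen_schur_int (fun i => A (- i.+1%:Z))); lia.
Qed.

Lemma schur_int_G n k N w : k <= N%:Z ->
  G n (schur_int k w) = schur_int k (G n w)
  - (t * cLa)^-1 *: \sum_(i < N) P (n - i.+1%:Z) (schur_int (k - i.+1%:Z) w).
Proof.
case: k => k le_kN; last first.
  rewrite !(@schur_int_neg (Negz k)) // linear0 big1 ?scaler0 ?subr0 // => i _.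
  by rewrite ?schur_int_neg ?linear0 //; lia.
rewrite [LHS]schur_op_G -scaler_sumr -scaleNr; congr (_ + _ *: _).
by apply: (widen_schur_int (fun i => P (n - i.+1%:Z))); lia.
Qed.

End Schur.

Lemma sum_schur_int_shift N D a w : (D < N%:Z) ->
  \sum_(j < N) schur_int 2 (D - j%:Z) (schur_int 2 (j%:Z - a%:Z) w) =
  \sum_(j < N) schur_int 2 (D - a%:Z - j%:Z) (schur_int 2 j%:Z w).
Proof.
move=> lt_DN.
rewrite -(@shift_sum _ (fun j => schur_int 2 (D - a%:Z - j) (schur_int 2 j w)) N a).
- by apply: eq_bigr => j _; congr (schur_int _ _ _); lia.
- by move=> j lt_j0; rewrite (schur_int_neg _ _ lt_j0) linear0.
- by move=> j le_j; rewrite schur_int_neg //; lia.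
Qed.

Lemma schur_intC s t k l w :
  schur_int s k (schur_int t l w) = schur_int t l (schur_int s k w).
Proof. by symmetry; apply: schur_int_commute => n u; rewrite schur_int_alpha. Qed.

Lemma schur_int0 t w : schur_int t 0 w = w.
Proof.
have -> : schur_int t 0 w = opser_exp (fun n => schur_term t n : M -> M) 0 w by [].
by rewrite /opser_exp big_ord1 /= /opser_one invr1 scale1r.
Qed.

Local Opaque schur_int.

Lemma schur_int_square_neg N k w : k < 0 ->
  \sum_(j < N) schur_int 2 (k - j%:Z) (schur_int 2 j%:Z w) = 0.
Proof. by move=> k0; rewrite big1 // => j _; rewrite schur_int_neg //; lia. Qed.

(** E^{1/2} E^{1/2} = E: both sides satisfy the recursion
    k x_k = - c_{L,alpha}^{-1} sum_l alpha(-l) x_{k-l}, with x_0 = 1. *)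
Lemma schur_int_square N k w : k < N%:Z ->
  \sum_(j < N) schur_int 2 (k - j%:Z) (schur_int 2 j%:Z w) = schur_int 1 k w.
Proof.
case: k => k; last by move=> _; rewrite schur_int_square_neg ?schur_int_neg.
elim/ltn_ind: k => k IH lt_kN.
case: (posnP k) => [k0|k_gt0].
  move: lt_kN; rewrite k0; case: N {IH} => // N _.
  rewrite big_ord_recl big1 ?addr0; first by rewrite !schur_int0.
  by move=> j _; rewrite schur_int_neg.
have kK : k%:R != 0 :> K by rewrite pnatr_eq0 -lt0n.
apply: (scalerI kK); rewrite (@schur_int_recursion 1 k N); last by lia.
have expand : k%:R *: \sum_(j < N) schur_int 2 (k%:Z - j%:Z) (schur_int 2 j%:Z w)
  = \sum_(j < N) ((k%:Z - j%:Z)%:~R *: schur_int 2 (k%:Z - j%:Z) (schur_int 2 j%:Z w)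
     + schur_int 2 (k%:Z - j%:Z) (j%:~R *: schur_int 2 j%:Z w)).
  rewrite scaler_sumr; apply: eq_bigr => j _.
  by rewrite linZ; lincomb.
rewrite expand big_split /=.
under eq_bigr => j _.
  rewrite (@schur_int_recursion 2 _ N); last by have := ltn_ord j; lia.
  over.
rewrite -scaler_sumr exchange_big /=.
under [X in _ + X]eq_bigr => j _.
  rewrite (@schur_int_recursion 2 _ N); last by have := ltn_ord j; lia.
  rewrite linZ linear_sum /=.
  under eq_bigr do rewrite schur_int_alpha.
  over.
rewrite -[X in _ + X]scaler_sumr [X in _ + _ *: X]exchange_big /=.
under eq_bigr do rewrite -linear_sum.
under [X in _ + _ *: X]eq_bigr do rewrite -linear_sum.
have T l : \sum_(j < N) schur_int 2 (k%:Z - l.+1%:Z - j%:Z) (schur_int 2 j w)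
    = schur_int 1 (k%:Z - l.+1%:Z) w.
  case: (ltnP l k) => lt_lk; last first.
    by rewrite schur_int_square_neg ?schur_int_neg //; lia.
  by rewrite subzn // IH //; lia.
under eq_bigr => l _.
  under eq_bigr do rewrite addrAC.
  rewrite T.
  over.
under [X in _ + _ *: X]eq_bigr => l _.
  rewrite sum_schur_int_shift ?T; last by lia.
  over.
by rewrite mul1r invfM; move: (\sum_(i < N) _) cLa_neq0 => x c0; lincomb.
Qed.

(** The coefficients y_j of Psi(z) E(z)^{1/2}, truncated to N creation modes of Psi,
    which is enough for j < N. *)
Section Annihilation.
Variable N : nat.

Definition dressed_psi_fun (j : int) (w : M) : M :=
  \sum_(a < N) P (- a.+1%:Z) (schur_int 2 (j - a%:Z) w).

Lemma dressed_psi_fun_linear j : is_linear_map (dressed_psi_fun j).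
Proof.
move=> a u w; rewrite /dressed_psi_fun scaler_sumr -big_split; apply: eq_bigr => i _.
by rewrite !linearP.
Qed.

Definition dressed_psi j : {linear M -> M} := lin_of (dressed_psi_fun_linear j).

Lemma dressed_psiE j w :
  dressed_psi j w = \sum_(a < N) P (- a.+1%:Z) (schur_int 2 (j - a%:Z) w).
Proof. by []. Qed.
Local Opaque dressed_psi.

Lemma vacuum_like_dressed_psi j w : vacuum_like w -> vacuum_like (dressed_psi j w).
Proof.
move=> Vw; rewrite dressed_psiE; apply: vacuum_like_sum => a.
exact/vacuum_likeP/vacuum_like_schur_int.
Qed.

Lemma dressed_psi_schur_int t j k w :
  dressed_psi j (schur_int t k w) = schur_int t k (dressed_psi j w).
Proof.
rewrite !dressed_psiE linear_sum; apply: eq_bigr => a _.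
by rewrite schur_intC schur_int_psi.
Qed.

Lemma dressed_psi_degree j w :
  L 0 (dressed_psi j w) = dressed_psi j (L 0 w) + (j%:~R + 2^-1) *: dressed_psi j w.
Proof.
rewrite !dressed_psiE linear_sum scaler_sumr -big_split; apply: eq_bigr => a _.
rewrite L0_psi schur_int_degree linearD linZ /=.
by rewrite !rmorphN /= !rmorphB /=; lincomb.
Qed.

Lemma psi_schurE (j : nat) w : vacuum_like w -> (j < N)%N ->
  psi_schur cLa rho (- j.+1%:Z) w = dressed_psi j w.
Proof.
move=> Vw lt_jN; rewrite /psi_schur (@fsum_nat _ j.+1) => [|i lt_ji]; last first.
  case: (vacuum_like_schur_int 2 i Vw) => _ FP _.
  by apply: FP; lia.
pose F a := P (- a.+1%:Z) (schur_int 2 (j%:Z - a%:Z) w).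
rewrite dressed_psiE (reindex_inj rev_ord_inj) /=.
transitivity (\sum_(i < j.+1) F i).
  apply: eq_bigr => i _; rewrite /F; have lt_ij := ltn_ord i.
  have -> : j%:Z - i%:Z = (j.+1 - i.+1)%N by lia.
  by congr (P _ _); lia.
rewrite (big_ord_widen N F lt_jN) big_mkcond; apply: eq_bigr => i _.
by case: ifP => // /negbT lt_ij; rewrite schur_int_neg ?linear0 //; lia.
Qed.

(** The coefficient of Psi(z) Psi(z) e(z), where Psi(z) Psi(z) = 0. *)
Lemma fermion_square_sum c w :
  \sum_(a < N) \sum_(b < N)
     P (- a.+1%:Z) (P (- b.+1%:Z) (schur_int 2 (c - a%:Z - b%:Z) w)) = 0.
Proof.
set s := LHS; have : s = - s.
  rewrite {1}/s exchange_big -sumrN; apply: eq_bigr => a _.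
  rewrite -sumrN; apply: eq_bigr => b _.
  by rewrite psi_psi addrAC.
move/eqP; rewrite -subr_eq0 opprK -mulr2n -scaler_nat scaler_eq0 pnatr_eq0 /=.
by move/eqP.
Qed.

Lemma fermion_square_shift (n j : nat) w : vacuum_like w -> (j < N)%N ->
  \sum_(a < N) \sum_(b < N)
     P (- a.+1%:Z) (P (n%:Z - b.+1%:Z) (schur_int 2 (j%:Z - a%:Z - b.+1%:Z) w)) = 0.
Proof.
move=> Vw lt_jN; rewrite -[RHS](fermion_square_sum (j%:Z - n%:Z - 1) w).
apply: eq_bigr => a _.
pose F b := P (- a.+1%:Z) (P (- (b + 1))
  (schur_int 2 (j%:Z - n%:Z - 1 - a%:Z - b) w)).
transitivity (\sum_(b < N) F (b%:Z - n%:Z)).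
  by apply: eq_bigr => b _; congr (P _ (P _ (schur_int _ _ _))); lia.
rewrite shift_sum /F => [|b b0|b le_b].
- by apply: eq_bigr => b _; congr (P _ (P _ (schur_int _ _ _))); lia.
- case: (vacuum_like_schur_int 2 (j%:Z - n%:Z - 1 - a%:Z - b) Vw).
  by move=> _ -> ; rewrite ?linear0 //; lia.
- by rewrite schur_int_neg ?linear0 //; lia.
Qed.

(** The coefficient of alpha(z) e(z): the modes alpha(-k), k > 0, give a multiple of
    the derivative of e by Newton's recursion, and alpha(0) gives its eigenvalue. *)
Lemma boson_sum (n j : nat) w : vacuum_like w -> (j < N)%N ->
  \sum_(a < N) A (n%:Z - a%:Z) (schur_int 2 (j%:Z - a%:Z) w) =
  (cLa * (1 + p%:R - 2 * (j%:R - n%:R))) *: schur_int 2 (j%:Z - n%:Z) w.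
Proof.
move=> Vw lt_jN.
pose F b := A (- b) (schur_int 2 (j%:Z - n%:Z - b) w).
transitivity (\sum_(a < N) F (a%:Z - n%:Z)).
  by apply: eq_bigr => b _; congr (A _ (schur_int _ _ _)); lia.
rewrite shift_sum /F => [|b b0|b le_b].
- case: N lt_jN => // N1 lt_jN; rewrite big_ord_recl /= subr0 oppr0.
  case: (vacuum_like_schur_int 2 (j%:Z - n%:Z) Vw) => _ _ ->.
  set x := schur_int _ _ _; set S := \sum_(i < N1) _.
  have rec : (j%:Z - n%:Z)%:~R *: x = - (2 * cLa)^-1 *: S.
    rewrite (@schur_int_recursion 2 (j%:Z - n%:Z) N1); last by lia.
    by congr (_ *: _); apply: eq_bigr => i _; congr (A _ (schur_int _ _ _)); lia.
  have inv : S = - (2 * cLa) *: (- (2 * cLa)^-1 *: S).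
    by move: cLa_neq0 => c0; lincomb.
  by rewrite inv -rec rmorphB /= -!pmulrn; lincomb.
- case: (vacuum_like_schur_int 2 (j%:Z - n%:Z - b) Vw).
  by move=> FA _ _; apply: FA; lia.
- by rewrite schur_int_neg ?linear0 //; lia.
Qed.

Lemma central_sum (n j : nat) w : (j < N)%N ->
  \sum_(a < N) ((2 * - a.+1%:Z)%:~R * (n == a :> nat)%:R * cLa)
    *: schur_int 2 (j%:Z - a%:Z) w =
  - (cLa * (2 * (n%:R + 1))) *: schur_int 2 (j%:Z - n%:Z) w.
Proof.
move=> lt_jN; case: (ltnP n N) => lt_nN; last first.
  rewrite schur_int_neg ?scaler0 ?big1 // => [a _|]; last by lia.
  have /negPf -> : n != a :> nat by have := ltn_ord a; lia.
  by rewrite mulr0 mul0r scale0r.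
rewrite (bigD1 (Ordinal lt_nN)) //= eqxx big1 ?addr0 => [|a].
  by congr (_ *: _); rewrite rmorphM rmorphN /= -pmulrn; ring.
rewrite -val_eqE /= eq_sym => /negPf ->.
by rewrite mulr0 mul0r scale0r.
Qed.

(** The three contributions to G(n+1/2) y_j: the quadratic one vanishes, and the
    bosonic and central ones add up to a multiple of e_{j-n} whose factor
    2 j + 1 - p is antisymmetric under j |-> p - 1 - j. *)
Lemma dressed_psi_G (n j : nat) w : vacuum_like w -> (j < N)%N ->
  G n (dressed_psi j w) =
    - dressed_psi j (G n w)
    - (cLa * (2 * j%:R + 1 - p%:R)) *: schur_int 2 (j%:Z - n%:Z) w.
Proof.
move=> Vw lt_jN; rewrite !dressed_psiE linear_sum.
have step (a : nat) : (a < N)%N ->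
    G n (P (- a.+1%:Z) (schur_int 2 (j%:Z - a%:Z) w)) =
    - P (- a.+1%:Z) (schur_int 2 (j%:Z - a%:Z) (G n w))
    + (2 * cLa)^-1 *: \sum_(b < N) P (- a.+1%:Z) (P (n%:Z - b.+1%:Z)
        (schur_int 2 (j%:Z - a%:Z - b.+1%:Z) w))
    + A (n%:Z - a%:Z) (schur_int 2 (j%:Z - a%:Z) w)
    + ((2 * - a.+1%:Z)%:~R * (n == a :> nat)%:R * cLa)
       *: schur_int 2 (j%:Z - a%:Z) w.
  move=> lt_aN; rewrite G_psi (@schur_int_G 2 n _ N); last by lia.
  rewrite linearB linZ linear_sum /=.
  have -> : - a.+1%:Z + n%:Z + 1 = n%:Z - a%:Z by lia.
  by rewrite subr_eq0 eqz_nat opprB [X in X + _ + _]addrC.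
under eq_bigr => a _ do rewrite step //.
rewrite !big_split /= -scaler_sumr fermion_square_shift // boson_sum //.
rewrite central_sum // sumrN.
set x := schur_int _ _ _; set y := \sum_(a < N) _.
by lincomb.
Qed.

Lemma dressed_psi_G_annihilated (n j : nat) w : vacuum_like w -> (j < N)%N ->
  G n w = 0 -> G n (dressed_psi j w) =
    - (cLa * (2 * j%:R + 1 - p%:R)) *: schur_int 2 (j%:Z - n%:Z) w.
Proof.
by move=> Vw lt_jN Gw; rewrite dressed_psi_G // Gw linear0 oppr0 add0r scaleNr.
Qed.

End Annihilation.

Hypothesis p_even : ~~ odd p.
Local Notation q := (p./2).
Local Notation Y := (dressed_psi p).

Lemma p_half : p = (q + q)%N.
Proof. by rewrite addnn even_halfK. Qed.

(** The vector of the statement, with its infinite sums replaced by the finite ones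
    that they reduce to on v.  The indices of the two y add up to p - 1. *)
Definition u_vec : M := schur_int 1 p%:Z v
  + \sum_(k < q) ((k%:R + 1 / 2)^-1 * (2 * cLa ^+ 2)^-1) *:
      Y (q - k.+1)%N%:Z (Y (q + k)%N%:Z v).

Lemma u_pr_vec : u_pr cLa rho p v = u_vec.
Proof.
congr (_ + _); apply: eq_bigr => k _; rewrite scalerA; congr (_ *: _).
have lt_kq := ltn_ord k; have pq := p_half.
have -> : - k%:Z - q%:Z - 1 = - (q + k).+1%:Z by lia.
rewrite (@psi_schurE p); [|exact: vacuum_like_v|by lia].
have -> : k%:Z - q%:Z = - (q - k.+1)%N.+1%:Z by lia.
by rewrite (@psi_schurE p) //; [apply/vacuum_like_dressed_psi/vacuum_like_v|lia].
Qed.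

Lemma vacuum_like_u : vacuum_like u_vec.
Proof.
apply: vacuum_likeD; first exact/vacuum_like_schur_int/vacuum_like_v.
apply: vacuum_like_sum => k; apply: vacuum_likeZ.
exact/vacuum_like_dressed_psi/vacuum_like_dressed_psi/vacuum_like_v.
Qed.

(** Both parts of u are reduced to coefficients at z^{p-1-n}: the image of S_p is
    [lowering], which [fold_square] rewrites as the coefficient of e(z) y(z), and
    the fermionic part gives the same coefficient, split into halves. *)
Lemma G_u (n : nat) : G n u_vec = 0.
Proof.
have Gv : G n v = 0 by case: hw => _ _ pos _ _; apply: pos.
have Vv := vacuum_like_v.
rewrite linearD (@schur_int_G 1 n p p) // Gv linear0 sub0r (lin_sum (G n)).
have lowering : \sum_(a < p) P (n%:Z - a.+1%:Z) (schur_int 1 (p%:Z - a.+1%:Z) v)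
   = \sum_(a < p) P (- a.+1%:Z) (schur_int 1 (p%:Z - 1 - n%:Z - a%:Z) v).
  pose F a := P (- (a + 1)) (schur_int 1 (p%:Z - 1 - n%:Z - a) v).
  transitivity (\sum_(a < p) F (a%:Z - n%:Z)).
    by apply: eq_bigr => a _; congr (P _ (schur_int _ _ _)); lia.
  rewrite shift_sum /F => [|a a0|a le_a].
  - by apply: eq_bigr => a _; congr (P _ (schur_int _ _ _)); lia.
  - case: (vacuum_like_schur_int 1 (p%:Z - 1 - n%:Z - a) Vv).
    by move=> _ FP _; apply: FP; lia.
  - by rewrite schur_int_neg ?linear0 //; lia.
have fold_square : \sum_(a < p) P (- a.+1%:Z) (schur_int 1 (p%:Z - 1 - n%:Z - a%:Z) v)
   = \sum_(j < p) schur_int 2 (p%:Z - 1 - n%:Z - j%:Z) (Y j%:Z v).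
  under [RHS]eq_bigr => j _ do rewrite dressed_psiE linear_sum.
  rewrite exchange_big; apply: eq_bigr => a _.
  under [RHS]eq_bigr => j _ do rewrite schur_int_psi.
  rewrite -linear_sum sum_schur_int_shift; last by lia.
  by rewrite schur_int_square //; lia.
have halves (F : nat -> M) : \sum_(j < p) F j =
    \sum_(k < q) (F (q - k.+1)%N + F (q + k)%N).
  rewrite -(big_mkord xpredT F) {1}p_half big_mkord big_split_ord big_split /=.
  congr (_ + _).
  by rewrite (reindex_inj rev_ord_inj).
rewrite lowering fold_square.
rewrite (halves (fun j => schur_int 2 (p%:Z - 1 - n%:Z - j%:Z) (Y j%:Z v))).
rewrite scaler_sumr -sumrN -big_split big1 // => k _ /=.
have lt_kq := ltn_ord k; have pq := p_half.
have GY := dressed_psi_G_annihilated.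
rewrite (linZ (G n)) dressed_psi_G; [|exact: vacuum_like_dressed_psi|by lia].
rewrite GY //; last by lia.
rewrite (linZ (dressed_psi _ _)) dressed_psi_schur_int.
have -> : (q - k.+1)%N%:Z - n%:Z = p%:Z - 1 - n%:Z - (q + k)%N%:Z by lia.
have -> : (q + k)%N%:Z - n%:Z = p%:Z - 1 - n%:Z - (q - k.+1)%N%:Z by lia.
rewrite natrB // natrD.
have -> : p%:R = q%:R + q%:R :> K by rewrite {1}p_half natrD.
rewrite -[k.+1]addn1 natrD.
have k1 : 2 * k%:R + 1 != 0 :> K by rewrite lt0r_neq0 // ltr_wpDl // mulr_ge0.
have -> : (k%:R + 1 / 2)^-1 = 2 / (2 * k%:R + 1) :> K.
  have -> : k%:R + 1 / 2 = (2 * k%:R + 1) / 2 :> K by field.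
  by rewrite invfM invrK mulrC.
set x := schur_int _ _ _; set y := schur_int _ _ _.
move: cLa_neq0 (k%:R : K) k1 (q%:R : K) => c0 kk k1 qq.
by lincomb; field; rewrite ?k1 ?c0.
Qed.

Lemma u_degree : L 0 u_vec = (h + p%:R) *: u_vec.
Proof.
have L0v : L 0 v = h *: v by case: hw.
rewrite linearD schur_int_degree L0v (linZ (schur_int _ _)) -scalerDl [RHS]scalerDr.
rewrite (lin_sum (L 0)) -pmulrn; congr (_ + _); rewrite scaler_sumr.
apply: eq_bigr => k _; have lt_kq := ltn_ord k; have pq := p_half.
rewrite (linZ (L 0)) 2!dressed_psi_degree L0v (linD (Y _)) !(linZ (Y _)).
set x := Y _ _.
have -> : p%:R = (q - k.+1)%N%:R + (q + k)%N%:R + 1 :> K.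
  by rewrite -natrD natr1; congr (_%:R); lia.
rewrite -!pmulrn; move: (_^-1 * _) ((q - k.+1)%N%:R) ((q + k)%N%:R) => c a b.
by lincomb.
Qed.

Theorem u_annihilated x : sh_pos x -> rho x u_vec = 0.
Proof.
have [Apos Ppos _] := vacuum_like_u.
case: x => [n|n|m|m|||] //=; [|exact: Apos| |exact: Ppos]; last first.
  by case: m => // m _; apply: G_u.
case: n => // -[|n] // _.
have := hw_bracket (shG 0) (shG n) u_vec.
rewrite /= big_cons big_seq1 /= !G_u !linear0 ?scaler0 !add0r.
have -> : (n%:Z + 1 == 0) = false by lia.
rewrite mul0r scale0r addr0 => /esym/eqP; rewrite scaler_eq0 pnatr_eq0 /= => /eqP.
by rewrite addrC -intS.
Qed.

End HighestWeight.

(** * Intertwining operators *)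

Section Intertwining.
Variables (K : numFieldType) (cLa : K) (p : nat) (M N : lmodType K).
Variables (rho : sh_basis -> {linear M -> M}) (sigma : sh_basis -> {linear N -> N}).
Variable T : {linear M -> N}.
Hypothesis Trho : forall x w, T (rho x w) = sigma x (T w).

Lemma schur_int_map t k w : T (schur_int cLa rho t k w) = schur_int cLa sigma t k (T w).
Proof.
case: k => k; last by rewrite !schur_int_neg ?linear0.
apply: (opser_exp_intertwine (f := schur_term cLa rho t) (g := schur_term cLa sigma t)).
move=> i u; rewrite !schur_termE; case: eqP => _; first by rewrite linear0.
by rewrite 2!(linZ T) Trho.
Qed.

Lemma dressed_psi_map n j w : T (dressed_psi cLa rho n j w) = dressed_psi cLa sigma n j (T w).
Proof.
rewrite !dressed_psiE (lin_sum T); apply: eq_bigr => a _.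
by rewrite Trho schur_int_map.
Qed.

Lemma u_vec_map v : T (u_vec cLa p rho v) = u_vec cLa p sigma (T v).
Proof.
rewrite /u_vec (linD T) schur_int_map [X in _ + X](lin_sum T); congr (_ + _).
by apply: eq_bigr => k _; rewrite (linZ T) !dressed_psi_map.
Qed.

End Intertwining.

(** * Brackets of the fields of the Fock module with the oscillators *)

Definition fin_supp (J : choiceType) (V : nmodType) (f : J -> V) : Prop :=
  exists A : {fset J}, forall k, k \notin A -> f k = 0.

Section FiniteSupport.
Variables (K : fieldType) (J : choiceType) (M : lmodType K).

Lemma fsumD (f g : J -> M) : fin_supp f -> fin_supp g ->
  \sum_(k \in [set: J]%classic) (f k + g k) =
  \sum_(k \in [set: J]%classic) f k + \sum_(k \in [set: J]%classic) g k.
Proof.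
move=> [A fA] [B gB].
have f0 k : k \notin (A `|` B)%fset -> f k = 0.
  by rewrite in_fsetU negb_or => /andP [/fA].
have g0 k : k \notin (A `|` B)%fset -> g k = 0.
  by rewrite in_fsetU negb_or => /andP [_ /gB].
rewrite !(fsbigTE (A `|` B)%fset) ?big_split // => k kN.
by rewrite f0 ?g0 ?addr0.
Qed.

Lemma fsum_lin (N : lmodType K) (T : {linear M -> N}) (f : J -> M) :
  fin_supp f ->
  T (\sum_(k \in [set: J]%classic) f k) = \sum_(k \in [set: J]%classic) T (f k).
Proof.
move=> [A fA]; rewrite !(fsbigTE A) ?lin_sum // => k kN.
by rewrite fA ?linear0.
Qed.

Lemma fsumZ a (f : J -> M) : fin_supp f ->
  \sum_(k \in [set: J]%classic) a *: f k = a *: \sum_(k \in [set: J]%classic) f k.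
Proof.
move=> [A fA]; rewrite !(fsbigTE A) ?scaler_sumr // => k kN.
by rewrite fA ?scaler0.
Qed.

Lemma fsum1 k0 (f : J -> M) : (forall k, k != k0 -> f k = 0) ->
  \sum_(k \in [set: J]%classic) f k = f k0.
Proof.
move=> f0; rewrite (fsbigTE [fset k0]%fset) ?big_seq_fset1 // => k.
by rewrite in_fset1 => /f0.
Qed.

Lemma fin_supp1 k0 (f : J -> M) : (forall k, k != k0 -> f k = 0) -> fin_supp f.
Proof. by move=> f0; exists [fset k0]%fset => k; rewrite in_fset1 => /f0. Qed.

Lemma fin_suppD (f g : J -> M) :
  fin_supp f -> fin_supp g -> fin_supp (fun k => f k + g k).
Proof.
move=> [A fA] [B gB]; exists (A `|` B)%fset => k.
by rewrite in_fsetU negb_or => /andP [/fA -> /gB ->]; rewrite addr0.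
Qed.

Lemma fin_supp_lin (N : lmodType K) (T : {linear M -> N}) (f : J -> M) :
  fin_supp f -> fin_supp (fun k => T (f k)).
Proof. by move=> [A fA]; exists A => k /fA ->; rewrite linear0. Qed.

Lemma fin_suppZ (c : J -> K) (f : J -> M) :
  fin_supp f -> fin_supp (fun k => c k *: f k).
Proof. by move=> [A fA]; exists A => k /fA ->; rewrite scaler0. Qed.

End FiniteSupport.

Lemma fin_supp_int (K : fieldType) (M : lmodType K) (f : int -> M) (B : int) :
  (forall k, B <= `|k| -> f k = 0) -> fin_supp f.
Proof.
move=> fB; exists [fset (i%:Z - `|B|%:Z) | i in iota 0 (2 * `|B|)]%fset => k kN.
apply: fB; rewrite leNgt; apply/negP => lt_kB; move/negP: kN; apply.
apply/imfsetP; exists `|(k + `|B|%:Z)%R|%N => /=; last by lia.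
by rewrite mem_iota; lia.
Qed.

Section Fock.
Variables (K : numClosedFieldType) (cL p r : K) (F : lmodType K).
Variables (o : osc -> {linear F -> F}) (v : F).
Hypothesis fock : is_fock cL p r (fun x => o x) v.

Lemma osc_rel x y w : o x (o y w) =
  (-1) ^+ (osc_odd x && osc_odd y) *: o y (o x w) + osc_bracket K x y *: w.
Proof. by case: fock => [[_ rel] _ _ _ _]; rewrite -rel addrC subrK. Qed.

(** The index of the modes that pair nontrivially with z. *)
Definition conj_mode (z : osc) : int :=
  if osc_odd z then - osc_mode z - 1 else - osc_mode z.

Lemma osc_bracket_parity x y : osc_odd x != osc_odd y -> osc_bracket K x y = 0.
Proof. by case: x y => [k|k|k|k] [l|l|l|l]. Qed.

Lemma osc_bracket_conj x z : osc_mode x != conj_mode z -> osc_bracket K x z = 0.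
Proof.
have zero (b : bool) (c : K) : ~~ b -> c * b%:R = 0.
  by move/negPf->; rewrite mulr0.
have zero1 (b : bool) : ~~ b -> b%:R = 0 :> K by move/negPf->.
by case: x z => [k|k|k|k] [l|l|l|l] //=; rewrite /conj_mode /= => kl;
  rewrite ?zero ?zero1 //; lia.
Qed.

(** Sufficiently high modes annihilate a given vector, since they supercommute with
    all the modes that created it; this makes the sums defining L and G finite. *)
Lemma smooth w : exists N : nat, forall x, N%:Z <= osc_mode x -> o x w = 0.
Proof.
case: fock => _ [vc vd vp vm] _ _ gen; apply: (gen (fun w =>
  exists N : nat, forall x, N%:Z <= osc_mode x -> o x w = 0)).
- exists 1%N => -[k|k|k|k] /= k1; [apply: vc|apply: vd|apply: vp|apply: vm]; lia.
- by exists 0%N => x _; rewrite linear0.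
- move=> a u w' [N1 H1] [N2 H2]; exists (maxn N1 N2) => x hx.
  by rewrite linearP H1 ?H2 ?scaler0 ?addr0 //; lia.
- move=> x u [N H]; exists (N + `|conj_mode x|.+1)%N => y hy.
  rewrite osc_rel H; last by lia.
  rewrite linear0 scaler0 add0r osc_bracket_conj ?scale0r //.
  by apply/eqP => E; lia.
Qed.

Lemma normal_order_linear x y : is_linear_map (normal_order (fun x => o x) x y).
Proof.
move=> a u w; rewrite /normal_order; case: ifP => _; first by rewrite (linP (o y)) (linP (o x)).
by rewrite (linP (o x)) (linP (o y)); lincomb.
Qed.

Definition nord x y : {linear F -> F} := lin_of (normal_order_linear x y).

Lemma nordE x y w : nord x y w = if osc_mode x < 0 then o x (o y w)
  else (-1) ^+ (osc_odd x && osc_odd y) *: o y (o x w).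
Proof. by []. Qed.

(** Normal ordering changes a product by a scalar, so it does not affect the bracket
    with z. *)
Lemma nord_osc x y z w : nord x y (o z w) =
  (-1) ^+ ((osc_odd x (+) osc_odd y) && osc_odd z) *: o z (nord x y w)
  + osc_bracket K y z *: o x w
  + ((-1) ^+ (osc_odd y && osc_odd z) * osc_bracket K x z) *: o y w.
Proof.
rewrite !nordE; case: ifP => _.
  rewrite (osc_rel y z) (linD (o x)) !(linZ (o x)) (osc_rel x z).
  by case: (osc_odd x) (osc_odd y) (osc_odd z) => [] [] []; lincomb.
rewrite (osc_rel x z) (linD (o y)) !(linZ (o y)) (osc_rel y z) (linZ (o z)).
have := @osc_bracket_parity y z; have := @osc_bracket_parity x z.
by case: (osc_odd x) (osc_odd y) (osc_odd z) => [] [] [] //= H1 H2;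
  try rewrite (H1 isT); try rewrite (H2 isT); lincomb.
Qed.

(** The mode of index s of a normally ordered product of two fields, with coefficients
    c that account for derivatives.  In its bracket with an oscillator z, one
    index k contributes for each of the two factors. *)
Section Quadratic.
Variables (X Y : int -> osc) (s : int) (px py : bool) (c : int -> K).
Hypothesis modeX : forall k, osc_mode (X k) = k.
Hypothesis modeY : forall k, osc_mode (Y k) = s - k.
Hypothesis oddX : forall k, osc_odd (X k) = px.
Hypothesis oddY : forall k, osc_odd (Y k) = py.

Lemma quad_fin_supp w : fin_supp (fun k => c k *: nord (X k) (Y k) w).
Proof.
apply: fin_suppZ; case: (smooth w) => N HN.
apply: (@fin_supp_int _ _ _ (N%:Z + `|s|)) => k hk.
rewrite nordE modeX; case: ifP => k0.
  by rewrite (HN (Y k)) ?linear0 // modeY; lia.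
by rewrite (HN (X k)) ?linear0 ?scaler0 // modeX; lia.
Qed.

Definition quad_fun (w : F) : F :=
  \sum_(k \in [set: int]%classic) c k *: nord (X k) (Y k) w.

Lemma quad_linear : is_linear_map quad_fun.
Proof.
move=> a u w; rewrite /quad_fun -(fsumZ a (quad_fin_supp u)).
rewrite -fsumD; [|exact/(fin_suppZ (fun=> a))/quad_fin_supp|exact: quad_fin_supp].
by apply: eq_fsbigr => k _; rewrite (linP (nord _ _)); lincomb.
Qed.

Definition quad : {linear F -> F} := lin_of quad_linear.

Lemma quadE w : quad w = \sum_(k \in [set: int]%classic) c k *: nord (X k) (Y k) w.
Proof. by []. Qed.

Lemma quad_osc z w (k1 := s - conj_mode z) (k2 := conj_mode z) :
  quad (o z w) = (-1) ^+ ((px (+) py) && osc_odd z) *: o z (quad w)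
  + (c k1 * osc_bracket K (Y k1) z) *: o (X k1) w
  + (c k2 * ((-1) ^+ (py && osc_odd z) * osc_bracket K (X k2) z)) *: o (Y k2) w.
Proof.
rewrite !quadE (fsum_lin (o z) (quad_fin_supp w)).
have Y0 k : k != k1 -> osc_bracket K (Y k) z = 0.
  by move=> kk; apply: osc_bracket_conj; rewrite modeY; lia.
have X0 k : k != k2 -> osc_bracket K (X k) z = 0.
  by move=> kk; apply: osc_bracket_conj; rewrite modeX.
pose f1 k := (c k * osc_bracket K (Y k) z) *: o (X k) w.
pose f2 k := (c k * ((-1) ^+ (py && osc_odd z) * osc_bracket K (X k) z)) *: o (Y k) w.
have f10 k : k != k1 -> f1 k = 0 by move=> /Y0 e; rewrite /f1 e mulr0 scale0r.
have f20 k : k != k2 -> f2 k = 0 by move=> /X0 e; rewrite /f2 e !mulr0 scale0r.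
rewrite -[X in _ + X + _](fsum1 f10) -[X in _ + X](fsum1 f20).
have fin0 := fin_suppZ (fun=> (-1) ^+ ((px (+) py) && osc_odd z))
  (fin_supp_lin (o z) (quad_fin_supp w)).
rewrite -(fsumZ _ (fin_supp_lin (o z) (quad_fin_supp w))).
rewrite -(fsumD fin0 (fin_supp1 f10)).
rewrite -(fsumD (fin_suppD fin0 (fin_supp1 f10)) (fin_supp1 f20)).
apply: eq_fsbigr => k _; rewrite nord_osc oddX oddY (linZ (o z)) /f1 /f2.
by lincomb.
Qed.

End Quadratic.
Local Opaque quad.

Section Modes.
Variable n : int.

Definition quad_cd : {linear F -> F} :=
  @quad oc (fun k => od (n - k)) n (fun=> 1) (fun=> erefl) (fun=> erefl).

Lemma fermion_mode (k : int) : n - k - 1 = n - 1 - k.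
Proof. by rewrite addrAC. Qed.

Definition quad_pm : {linear F -> F} :=
  @quad opsip (fun k => opsim (n - k - 1)) (n - 1) (fun k => (- (k + 1))%:~R)
    (fun=> erefl) fermion_mode.

Definition quad_mp : {linear F -> F} :=
  @quad opsim (fun k => opsip (n - k - 1)) (n - 1) (fun k => (- (k + 1))%:~R)
    (fun=> erefl) fermion_mode.

Definition quad_cp : {linear F -> F} :=
  @quad oc (fun k => opsip (n - k)) n (fun=> 1) (fun=> erefl) (fun=> erefl).

Definition quad_dm : {linear F -> F} :=
  @quad od (fun k => opsim (n - k)) n (fun=> 1) (fun=> erefl) (fun=> erefl).

Lemma fock_L_quad w : fock_L cL (fun x => o x) n w =
  2^-1 *: quad_cd w + ((cL - 3) / 24 * (- n - 1)%:~R) *: o (oc n) w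
  - (2^-1 * (- n - 1)%:~R) *: o (od n) w
  + 2^-1 *: quad_pm w + 2^-1 *: quad_mp w.
Proof.
rewrite /fock_L; congr (2^-1 *: _ + _ - _ + _ + _).
by apply: eq_fsbigr => k _; rewrite scale1r.
Qed.

Lemma fock_G_quad w : fock_G cL (fun x => o x) n w =
  sqrtC 2 *: (2^-1 *: quad_cp w + 2^-1 *: quad_dm w
    + ((cL - 3) / 12 * (- (n + 1))%:~R) *: o (opsim n) w
    - (- (n + 1))%:~R *: o (opsip n) w).
Proof.
rewrite /fock_G; congr (_ *: (2^-1 *: _ + 2^-1 *: _ + _ - _)).
  by apply: eq_fsbigr => k _; rewrite scale1r.
by apply: eq_fsbigr => k _; rewrite scale1r.
Qed.

Lemma fock_L_linear : is_linear_map (fock_L cL (fun x => o x) n).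
Proof.
move=> a u w; rewrite !fock_L_quad (linP quad_cd) (linP quad_pm) (linP quad_mp).
by rewrite (linP (o (oc n))) (linP (o (od n))); lincomb.
Qed.

Lemma fock_G_linear : is_linear_map (fock_G cL (fun x => o x) n).
Proof.
move=> a u w; rewrite !fock_G_quad (linP quad_cp) (linP quad_dm).
by rewrite (linP (o (opsip n))) (linP (o (opsim n))); lincomb.
Qed.

End Modes.

Section ModesOsc.
Variables (n : int) (z : osc) (w : F).
Local Notation k := (conj_mode z).

Lemma quad_cd_osc : quad_cd n (o z w) = o z (quad_cd n w)
  + osc_bracket K (od k) z *: o (oc (n - k)) w
  + osc_bracket K (oc k) z *: o (od (n - k)) w.
Proof.
have := @quad_osc oc (fun k => od (n - k)) n false false (fun=> 1)
  (fun=> erefl) (fun=> erefl) (fun=> erefl) (fun=> erefl) z w.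
by rewrite /= expr0 scale1r !mul1r subKr.
Qed.

Lemma quad_pm_osc : quad_pm n (o z w) = o z (quad_pm n w)
  + ((k - n)%:~R * osc_bracket K (opsim k) z) *: o (opsip (n - k - 1)) w
  + ((- (k + 1))%:~R * ((-1) ^+ osc_odd z * osc_bracket K (opsip k) z))
      *: o (opsim (n - k - 1)) w.
Proof.
have := @quad_osc opsip (fun k => opsim (n - k - 1)) (n - 1) true true
  (fun k => (- (k + 1))%:~R) (fun=> erefl) (fermion_mode n)
  (fun=> erefl) (fun=> erefl) z w.
rewrite /= expr0 scale1r.
have -> : n - (n - 1 - k) - 1 = k by lia.
have -> : - (n - 1 - k + 1) = k - n by lia.
by rewrite -!fermion_mode.
Qed.

Lemma quad_mp_osc : quad_mp n (o z w) = o z (quad_mp n w)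
  + ((k - n)%:~R * osc_bracket K (opsip k) z) *: o (opsim (n - k - 1)) w
  + ((- (k + 1))%:~R * ((-1) ^+ osc_odd z * osc_bracket K (opsim k) z))
      *: o (opsip (n - k - 1)) w.
Proof.
have := @quad_osc opsim (fun k => opsip (n - k - 1)) (n - 1) true true
  (fun k => (- (k + 1))%:~R) (fun=> erefl) (fermion_mode n)
  (fun=> erefl) (fun=> erefl) z w.
rewrite /= expr0 scale1r.
have -> : n - (n - 1 - k) - 1 = k by lia.
have -> : - (n - 1 - k + 1) = k - n by lia.
by rewrite -!fermion_mode.
Qed.

Lemma quad_cp_osc : quad_cp n (o z w) = (-1) ^+ osc_odd z *: o z (quad_cp n w)
  + osc_bracket K (opsip k) z *: o (oc (n - k)) w
  + ((-1) ^+ osc_odd z * osc_bracket K (oc k) z) *: o (opsip (n - k)) w.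
Proof.
have := @quad_osc oc (fun k => opsip (n - k)) n false true (fun=> 1)
  (fun=> erefl) (fun=> erefl) (fun=> erefl) (fun=> erefl) z w.
by rewrite /= !mul1r subKr.
Qed.

Lemma quad_dm_osc : quad_dm n (o z w) = (-1) ^+ osc_odd z *: o z (quad_dm n w)
  + osc_bracket K (opsim k) z *: o (od (n - k)) w
  + ((-1) ^+ osc_odd z * osc_bracket K (od k) z) *: o (opsim (n - k)) w.
Proof.
have := @quad_osc od (fun k => opsim (n - k)) n false true (fun=> 1)
  (fun=> erefl) (fun=> erefl) (fun=> erefl) (fun=> erefl) z w.
by rewrite /= !mul1r subKr.
Qed.

End ModesOsc.

(** L and G as families of linear maps.  They are opaque, because every later
    computation uses their brackets and never their definition by sums. *)
Fact fockL_spec : {T : int -> {linear F -> F} |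
  forall n w, T n w = fock_L cL (fun x => o x) n w}.
Proof. by exists (fun n => lin_of (fock_L_linear n)). Qed.

Fact fockG_spec : {T : int -> {linear F -> F} |
  forall n w, T n w = fock_G cL (fun x => o x) n w}.
Proof. by exists (fun n => lin_of (fock_G_linear n)). Qed.

Definition fockL : int -> {linear F -> F} := sval fockL_spec.
Definition fockG : int -> {linear F -> F} := sval fockG_spec.

Lemma fockL_quad n w : fockL n w =
  2^-1 *: quad_cd n w + ((cL - 3) / 24 * (- n - 1)%:~R) *: o (oc n) w
  - (2^-1 * (- n - 1)%:~R) *: o (od n) w
  + 2^-1 *: quad_pm n w + 2^-1 *: quad_mp n w.
Proof. by rewrite (svalP fockL_spec) fock_L_quad. Qed.

Lemma fockG_quad n w : fockG n w =
  sqrtC 2 *: (2^-1 *: quad_cp n w + 2^-1 *: quad_dm n w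
    + ((cL - 3) / 12 * (- (n + 1))%:~R) *: o (opsim n) w
    - (- (n + 1))%:~R *: o (opsip n) w).
Proof. by rewrite (svalP fockG_spec) fock_G_quad. Qed.

Local Opaque quad_cd quad_pm quad_mp quad_cp quad_dm.

Ltac osc_simpl :=
  rewrite ?(linZ (o _)) ?(linD (o _)) ?(linN (o _)) ?(linZ (o _));
  rewrite /= /conj_mode /= /heis_form /=.

Lemma fockL_c n m w : fockL n (o (oc m) w) = o (oc m) (fockL n w)
  - m%:~R *: o (oc (n + m)) w + ((n ^+ 2 + n)%:~R * (n + m == 0)%:R) *: w.
Proof.
rewrite !fockL_quad quad_cd_osc quad_pm_osc quad_mp_osc (osc_rel (oc n)) (osc_rel (od n)).
osc_simpl; rewrite opprK addNr eqxx; lincomb.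
Qed.

Lemma fockL_d n m w : fockL n (o (od m) w) = o (od m) (fockL n w)
  - m%:~R *: o (od (n + m)) w
  - ((cL - 3) / 12 * (n ^+ 2 + n)%:~R * (n + m == 0)%:R) *: w.
Proof.
rewrite !fockL_quad quad_cd_osc quad_pm_osc quad_mp_osc (osc_rel (oc n)) (osc_rel (od n)).
osc_simpl; rewrite opprK addNr eqxx; lincomb.
Qed.

Lemma conj_fermion (n m : int) :
  ((- m - 1 + m + 1 == 0) = true) * (n - (- m - 1) - 1 = n + m)
  * (n - (- m - 1) = n + m + 1) * (m + (- m - 1) + 1 = 0).
Proof. by do !split; lia. Qed.

Lemma fockL_psip n m w : fockL n (o (opsip m) w) = o (opsip m) (fockL n w)
  - (n%:~R / 2 + m%:~R + 2^-1) *: o (opsip (n + m)) w.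
Proof.
rewrite !fockL_quad quad_cd_osc quad_pm_osc quad_mp_osc (osc_rel (oc n)) (osc_rel (od n)).
osc_simpl; rewrite !(conj_fermion n m) ?addrK; lincomb.
Qed.

Lemma fockL_psim n m w : fockL n (o (opsim m) w) = o (opsim m) (fockL n w)
  - (n%:~R / 2 + m%:~R + 2^-1) *: o (opsim (n + m)) w.
Proof.
rewrite !fockL_quad quad_cd_osc quad_pm_osc quad_mp_osc (osc_rel (oc n)) (osc_rel (od n)).
osc_simpl; rewrite !(conj_fermion n m) ?addrK; lincomb.
Qed.

Lemma fockG_c n m w : fockG n (o (oc m) w) = o (oc m) (fockG n w)
  - (sqrtC 2 * m%:~R) *: o (opsim (n + m)) w.
Proof.
rewrite !fockG_quad quad_cp_osc quad_dm_osc (osc_rel (opsip n)) (osc_rel (opsim n)).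
osc_simpl; rewrite opprK addNr eqxx; lincomb.
Qed.

Lemma fockG_d n m w : fockG n (o (od m) w) = o (od m) (fockG n w)
  - (sqrtC 2 * m%:~R) *: o (opsip (n + m)) w.
Proof.
rewrite !fockG_quad quad_cp_osc quad_dm_osc (osc_rel (opsip n)) (osc_rel (opsim n)).
osc_simpl; rewrite opprK addNr eqxx; lincomb.
Qed.

Lemma fockG_psip n m w : fockG n (o (opsip m) w) = - o (opsip m) (fockG n w)
  + (sqrtC 2 / 2) *: o (od (n + m + 1)) w
  - (sqrtC 2 * ((cL - 3) / 12) * (n + 1)%:~R * (n + m + 1 == 0)%:R) *: w.
Proof.
rewrite !fockG_quad quad_cp_osc quad_dm_osc (osc_rel (opsip n)) (osc_rel (opsim n)).
osc_simpl; rewrite !(conj_fermion n m) ?addrK; lincomb.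
Qed.

Lemma fockG_psim n m w : fockG n (o (opsim m) w) = - o (opsim m) (fockG n w)
  + (sqrtC 2 / 2) *: o (oc (n + m + 1)) w
  + (sqrtC 2 * (n + 1)%:~R * (n + m + 1 == 0)%:R) *: w.
Proof.
rewrite !fockG_quad quad_cp_osc quad_dm_osc (osc_rel (opsip n)) (osc_rel (opsim n)).
osc_simpl; rewrite !(conj_fermion n m) ?addrK; lincomb.
Qed.

End Fock.

(** * Relations between the fields of the Fock module *)

Section FockModule.
Variables (K : numClosedFieldType) (cL p r : K) (F : lmodType K).
Variables (o : osc -> {linear F -> F}) (v : F).
Hypothesis fock : is_fock cL p r (fun x => o x) v.
Local Notation L := (fockL fock).
Local Notation G := (fockG fock).

(** Everything that is known of v but for its being nonzero and generating. *)
Definition vacuum (w : F) : Prop :=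
  [/\ (forall n, 0 < n -> o (oc n) w = 0) /\ (forall n, 0 < n -> o (od n) w = 0),
      (forall m, 0 <= m -> o (opsip m) w = 0) /\
      (forall m, 0 <= m -> o (opsim m) w = 0),
      o (oc 0) w = heis_form (1, 0) (fock_weight cL p r) *: w &
      o (od 0) w = heis_form (0, 1) (fock_weight cL p r) *: w].

Lemma vacuum_v : vacuum v.
Proof. by case: fock => _ [vc vd vp vm] [v0 v1] _ _; split. Qed.

Lemma quad_at k0 (X Y : int -> osc) s c
    (hX : forall k, osc_mode (X k) = k) (hY : forall k, osc_mode (Y k) = s - k) w :
  (forall k, k != k0 -> nord o (X k) (Y k) w = 0) ->
  quad fock c hX hY w = c k0 *: nord o (X k0) (Y k0) w.
Proof.
move=> z; rewrite quadE (fsum1 (k0 := k0)) // => k /z ->.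
by rewrite scaler0.
Qed.

Definition annihilating (z : osc) : bool :=
  if osc_odd z then 0 <= osc_mode z else 0 < osc_mode z.

Section OnVacuum.
Variable w : F.
Hypothesis vac : vacuum w.

Lemma vacuum_annihilating z : annihilating z -> o z w = 0.
Proof.
by case: vac => [[vc vd] [vp vm] _ _]; case: z => k; [exact: vc|exact: vd|exact: vp|exact: vm].
Qed.

Lemma vacuum_eigen z : 0 <= osc_mode z -> exists a, o z w = a *: w.
Proof.
have [[z0 _]|hz] := pselect ((osc_mode z = 0 /\ ~~ osc_odd z) /\ 0 <= osc_mode z).
  case: vac => [_ _ c0 d0]; case: z z0 => k /= [-> _] // _.
    by exists (heis_form (1, 0) (fock_weight cL p r)).
  by exists (heis_form (0, 1) (fock_weight cL p r)).
move=> z0; exists 0; rewrite scale0r vacuum_annihilating // /annihilating.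
by case: z hz z0 => k /=; lia.
Qed.

Lemma nord_vacuum x y :
  (osc_mode x < 0 -> annihilating y) ->
  (0 <= osc_mode x -> annihilating x \/ annihilating y) -> nord o x y w = 0.
Proof.
rewrite nordE; case: ifP => x0 Hneg Hpos.
  by rewrite (vacuum_annihilating (Hneg isT)) linear0.
have {}x0 : 0 <= osc_mode x by rewrite leNgt x0.
case: (Hpos x0) => /vacuum_annihilating a0; first by rewrite a0 linear0 scaler0.
by case: (vacuum_eigen x0) => a ->; rewrite (linZ (o y)) a0 !scaler0.
Qed.

Lemma quad_vacuum (X Y : int -> osc) s c
    (hX : forall k, osc_mode (X k) = k) (hY : forall k, osc_mode (Y k) = s - k) :
  (forall k, (k < 0 -> annihilating (Y k)) /\
     (0 <= k -> annihilating (X k) \/ annihilating (Y k))) ->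
  quad fock c hX hY w = 0.
Proof.
move=> H; have nord0 k : nord o (X k) (Y k) w = 0.
  by case: (H k) => h1 h2; apply: nord_vacuum; rewrite hX.
by rewrite (@quad_at 0) => [|k _]; rewrite nord0 ?scaler0.
Qed.

Lemma L_vacuum n : 0 < n -> L n w = 0.
Proof.
move=> n0; rewrite fockL_quad.
have -> : quad_cd fock n w = 0.
  by apply: quad_vacuum => k; rewrite /annihilating /=; lia.
have -> : quad_pm fock n w = 0.
  by apply: quad_vacuum => k; rewrite /annihilating /=; lia.
have -> : quad_mp fock n w = 0.
  by apply: quad_vacuum => k; rewrite /annihilating /=; lia.
by rewrite !vacuum_annihilating // !scaler0 !subr0 !addr0.
Qed.

Lemma G_vacuum n : 0 <= n -> G n w = 0.
Proof.
move=> n0; rewrite fockG_quad.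
have -> : quad_cp fock n w = 0.
  by apply: quad_vacuum => k; rewrite /annihilating /=; lia.
have -> : quad_dm fock n w = 0.
  by apply: quad_vacuum => k; rewrite /annihilating /=; lia.
by rewrite !vacuum_annihilating // !scaler0 !subr0 !addr0 scaler0.
Qed.

Lemma L0_vacuum : L 0 w = h_pr cL p r *: w.
Proof.
rewrite fockL_quad.
have -> : quad_cd fock 0 w = 1 *: nord o (oc 0) (od 0) w.
  apply: quad_at => k k0; apply: nord_vacuum; rewrite /annihilating /=; lia.
have -> : quad_pm fock 0 w = 0.
  by apply: quad_vacuum => k; rewrite /annihilating /=; lia.
have -> : quad_mp fock 0 w = 0.
  by apply: quad_vacuum => k; rewrite /annihilating /=; lia.
rewrite nordE /=; case: vac => _ _ -> ->.
rewrite (linZ (o (od 0))); case: vac => _ _ _ ->.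
by rewrite /h_pr /heis_form /fock_weight /=; lincomb.
Qed.

End OnVacuum.

Definition osc_degree (z : osc) : K :=
  (osc_mode z)%:~R + (if osc_odd z then 2^-1 else 0).

Lemma L0_osc z w : L 0 (o z w) = o z (L 0 w) - osc_degree z *: o z w.
Proof.
rewrite /osc_degree; case: z => k; rewrite ?fockL_c ?fockL_d ?fockL_psip ?fockL_psim /= !add0r;
  by lincomb.
Qed.

Lemma L0_nord x y w : L 0 (nord o x y w) =
  nord o x y (L 0 w) - (osc_degree x + osc_degree y) *: nord o x y w.
Proof.
rewrite !nordE; case: ifP => _; rewrite ?(linZ (L 0)) !L0_osc.
  by rewrite (linD (o x)) (linN (o x)) (linZ (o x)); lincomb.
by rewrite (linD (o y)) (linN (o y)) (linZ (o y)); lincomb.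
Qed.

Lemma L0_quad D (X Y : int -> osc) s c
    (hX : forall k, osc_mode (X k) = k) (hY : forall k, osc_mode (Y k) = s - k) w :
  (forall k, osc_degree (X k) + osc_degree (Y k) = D) ->
  L 0 (quad fock c hX hY w) = quad fock c hX hY (L 0 w) - D *: quad fock c hX hY w.
Proof.
move=> deg; rewrite !quadE (fsum_lin (L 0) (quad_fin_supp fock c hX hY w)).
rewrite -scaleNr -(fsumZ (- D) (quad_fin_supp fock c hX hY w)).
rewrite -(fsumD (quad_fin_supp fock c hX hY (L 0 w))
  (fin_suppZ (fun=> - D) (quad_fin_supp fock c hX hY w))).
apply: eq_fsbigr => k _; rewrite (linZ (L 0)).
rewrite [L 0 (normal_order _ _ _ _)](L0_nord (X k) (Y k) w) deg.
rewrite -[RHS]/(c k *: nord o (X k) (Y k) (L 0 w)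
  + - D *: (c k *: nord o (X k) (Y k) w)).
by lincomb.
Qed.

Lemma L0_L n w : L 0 (L n w) = L n (L 0 w) - n%:~R *: L n w.
Proof.
rewrite !(fockL_quad fock n) !(linD (L 0)) (linN (L 0)) !(linZ (L 0)) !L0_osc.
rewrite (@L0_quad n%:~R) => [|k]; last first.
  by rewrite /osc_degree /=; field.
rewrite (@L0_quad n%:~R) => [|k]; last first.
  by rewrite /osc_degree /=; field.
rewrite (@L0_quad n%:~R) => [|k]; last first.
  by rewrite /osc_degree /=; field.
rewrite /osc_degree /=; lincomb.
Qed.

Lemma L0_G n w : L 0 (G n w) = G n (L 0 w) - (n%:~R + 2^-1) *: G n w.
Proof.
rewrite !(fockG_quad fock n) (linZ (L 0)) !(linD (L 0)) (linN (L 0)) !(linZ (L 0)) !L0_osc.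
rewrite (@L0_quad (n%:~R + 2^-1)) => [|k]; last first.
  by rewrite /osc_degree /=; field.
rewrite (@L0_quad (n%:~R + 2^-1)) => [|k]; last first.
  by rewrite /osc_degree /=; field.
rewrite /osc_degree /=; lincomb.
Qed.

(** An operator that supercommutes with all oscillators is determined by its value
    at v, and this value is again a vacuum. *)
Section Commutant.
Variables (D : F -> F) (b : bool).
Hypothesis linear_D : is_linear_map D.
Hypothesis commuting_D :
  forall z w, D (o z w) = (-1) ^+ (b && osc_odd z) *: o z (D w).

Lemma commutant0 : D 0 = 0.
Proof. exact: (linear0 (lin_of linear_D)). Qed.

Lemma commutantZ a w : D (a *: w) = a *: D w.
Proof. exact: (linZ (lin_of linear_D)). Qed.

Lemma commutant_eq0 : D v = 0 -> forall w, D w = 0.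
Proof.
move=> Dv; case: fock => _ _ _ _ gen; apply: (gen (fun w => D w = 0)) => //.
- exact: commutant0.
- by move=> a u w Du Dw; rewrite linear_D Du Dw scaler0 addr0.
- by move=> z w Dw; rewrite commuting_D Dw linear0 scaler0.
Qed.

Lemma commutant_vacuum : vacuum (D v).
Proof.
have Dz z a : o z v = a *: v -> o z (D v) = ((-1) ^+ (b && osc_odd z) * a) *: D v.
  move=> za; have := commuting_D z v; rewrite za commutantZ -scalerA => ->.
  by rewrite signrZK.
have D0 z : annihilating z -> o z (D v) = 0.
  move=> /(vacuum_annihilating vacuum_v) zv.
  by rewrite (Dz z 0) ?mulr0 scale0r.
have [_ _ cv dv] := vacuum_v.
split; first by split=> n n0; apply: D0.
- by split=> m m0; apply: D0.
- by rewrite (Dz _ _ cv) andbF mul1r.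
- by rewrite (Dz _ _ dv) andbF mul1r.
Qed.

(** L(0) has the eigenvalue h on D v, because D v is a vacuum, and also the eigenvalue
    h - d, because D has degree d. *)
Lemma graded_commutant_eq0 (d : K) : d != 0 ->
  (forall w, L 0 (D w) = D (L 0 w) - d *: D w) -> forall w, D w = 0.
Proof.
move=> d0 deg; apply: commutant_eq0.
have := deg v; rewrite (L0_vacuum commutant_vacuum) (L0_vacuum vacuum_v) commutantZ.
move/(congr1 (fun x => h_pr cL p r *: D v - x)); rewrite subrr subKr => /esym/eqP.
by rewrite scaler_eq0 (negPf d0) /= => /eqP.
Qed.

End Commutant.

Let LG_osc := (fockL_c fock, fockL_d fock, fockL_psip fock, fockL_psim fock,
  fockG_c fock, fockG_d fock, fockG_psip fock, fockG_psim fock).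

Ltac push_L :=
  rewrite ?LG_osc;
  repeat (progress (rewrite ?(linD (L _)) ?(linN (L _)) ?(linZ (L _))
    ?(linD (G _)) ?(linN (G _)) ?(linZ (G _)) ?LG_osc));
  rewrite ?(linD (o _)) ?(linN (o _)) ?(linZ (o _)) ?(linD (o _)) ?(linN (o _))
    ?(linZ (o _)).

(** The Jacobi identity for L(m), G(n+1/2) and an oscillator.  For a fermion it
    involves a scalar supported at k = - m - n - 1, whose coefficient vanishes only
    after substituting that value of k. *)
Lemma fock_LG_commutant m n :
  let D w := L m (G n w) - G n (L m w)
    - (m%:~R / 2 - n%:~R - 1 / 2) *: G (m + n) w in
  forall z w, D (o z w) = (-1) ^+ (true && osc_odd z) *: o z (D w).
Proof.
move=> D [k|k|k|k] w; rewrite /D; push_L.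
all: rewrite (addrCA n m k) !addrA.
- by lincomb.
- by lincomb.
- case: eqP => e; last by lincomb.
  lincomb; have {e}-> : k = - m - n - 1 by lia.
  by field.
- case: eqP => e; last by lincomb.
  lincomb; have {e}-> : k = - m - n - 1 by lia.
  by field.
Qed.

Lemma fock_GG_commutant m n :
  let D w := G m (G n w) + G n (G m w) - 2 *: L (m + n + 1) w
    - ((m + n + 1 == 0)%:R * ((m ^+ 2 + m)%:~R / 3 * cL)) *: w in
  forall z w, D (o z w) = (-1) ^+ (false && osc_odd z) *: o z (D w).
Proof.
move=> D [k|k|k|k] w; rewrite /D; push_L.
all: have s2 : sqrtC 2 ^+ 2 = 2 :> K by exact: sqrtCK.
all: move: (sqrtC 2) s2 => s s2.
all: rewrite ?(addrCA n m k) ?addrA ?(addrC n m) ?(addrAC _ 1 k).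
- case: eqP => e; lincomb; try by field : s2.
  have {e}-> : k = - m - n - 1 by lia.
  by field : s2.
- case: eqP => e; lincomb; try by field : s2.
  have {e}-> : k = - m - n - 1 by lia.
  by field : s2.
- by lincomb; field : s2.
- by lincomb; field : s2.
Qed.

(** The degree m + n + 1/2 is never zero. *)
Lemma fock_LG m n w : L m (G n w) = G n (L m w)
  + (m%:~R / 2 - n%:~R - 1 / 2) *: G (m + n) w.
Proof.
pose D w := L m (G n w) - G n (L m w) - (m%:~R / 2 - n%:~R - 1 / 2) *: G (m + n) w.
suff: D w = 0 by move/eqP; rewrite /D -addrA -opprD subr_eq0 => /eqP.
apply: (@graded_commutant_eq0 D true) (_ : (m + n)%:~R + 2^-1 != 0) _ w.
- move=> a u x; rewrite /D !(linP (G n)) !(linP (L m)) (linP (G (m + n))).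
  by rewrite (linP (G n)); lincomb.
- exact: fock_LG_commutant.
- have -> : (m + n)%:~R + 2^-1 = (2 * (m + n) + 1)%:~R / 2 :> K by field.
  by rewrite mulf_neq0 ?invr_eq0 ?pnatr_eq0 // intr_eq0; lia.
- move=> x; rewrite /D !(linD (L 0)) !(linN (L 0)) (linZ (L 0)).
  rewrite L0_L !L0_G L0_L (linD (L m)) (linN (L m)) (linZ (L m)).
  rewrite (linD (G n)) (linN (G n)) (linZ (G n)).
  by lincomb.
Qed.

(** On v the sums defining G(-n-1/2) reduce to the indices k = - i, 0 <= i <= n; the
    two factors of other terms cannot both be creation or zero modes. *)
Lemma fsum_neg_range (V : nmodType) n (f : int -> V) :
  (forall k, ~~ (- n%:Z <= k <= 0) -> f k = 0) ->
  \sum_(k \in [set: int]%classic) f k = \sum_(i < n.+1) f (- i%:Z).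
Proof.
move=> f0; rewrite (@fsbig_ord _ _ _ n.+1 (fun i : nat => f (- i%:Z))).
rewrite -(fsbig_image `I_n.+1%classic (fun i : nat => - i%:Z) f); last first.
  by move=> i j _ _; lia.
apply/esym/fsbig_widen => // k [_ /= notin]; apply: f0; apply/negP => range.
by apply: notin; exists `|k|%N => /=; lia.
Qed.

Lemma sum_first_integers (n : nat) : \sum_(i < n.+1) (i%:R : K) = n%:R * (n%:R + 1) / 2.
Proof.
elim: n => [|n IH]; first by rewrite big_ord1 mul0r mul0r.
rewrite big_ord_recr /= IH -[n.+1]addn1 natrD; by field.
Qed.

Section VacuumValue.
Variable n : nat.
Local Notation N := (- n%:Z - 1).

Lemma G_n_v : G n v = 0.
Proof. exact: (G_vacuum vacuum_v). Qed.

(** Up to the factor sqrt 2, the term of index k = - i > - n - 1 contributes i, by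
    contracting the fermion that G(n+1/2) makes of the boson X(-i); the term i = 0
    contributes the zero mode a of X times the value b of G(n+1/2) on the fermion. *)
Lemma G_quad_v (X Y Y' : int -> osc) (a b : K)
    (hX : forall k, osc_mode (X k) = k) (hY : forall k, osc_mode (Y (N - k)) = N - k) :
  (forall k, osc_odd (X k) = false) -> (forall k, osc_odd (Y k) = true) ->
  (forall k, osc_odd (Y' k) = true) -> (forall k, osc_mode (Y' k) = k) ->
  (forall k l, osc_bracket K (X k) (Y l) = 0) ->
  (forall k l, osc_bracket K (Y' k) (Y l) = (k + l + 1 == 0)%:R) ->
  (forall m w, G n (o (X m) w) =
     o (X m) (G n w) - (sqrtC 2 * m%:~R) *: o (Y' (n%:Z + m)) w) ->
  o (X 0) v = a *: v ->
  (forall i : nat, G n (o (Y (N + i%:Z)) v) =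
     (if i == 0%N then sqrtC 2 * b else 0) *: v) ->
  G n (@quad _ _ _ _ _ _ _ fock X (fun k => Y (N - k)) N (fun=> 1) hX hY v) =
  (sqrtC 2 * (n%:R * (n%:R + 1) / 2 + a * b)) *: v.
Proof.
move=> oddX oddY oddY' modeY' XY Y'Y GX X0 GY.
rewrite quadE (fsum_lin (G n) (quad_fin_supp fock _ hX hY v)).
rewrite (@fsum_neg_range _ n) => [|k out]; last first.
  rewrite scale1r nord_vacuum ?linear0 //; first exact: vacuum_v.
    by rewrite /annihilating hX hY oddY; lia.
  by rewrite /annihilating hX hY oddX oddY; lia.
have term (i : nat) : (i <= n)%N ->
    G n (1 *: nord o (X (- i%:Z)) (Y (N - - i%:Z)) v) =
    (sqrtC 2 * (i%:R + (if i == 0%N then a * b else 0))) *: v.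
  move=> le_in; rewrite scale1r opprK.
  have -> : nord o (X (- i%:Z)) (Y (N + i%:Z)) v = o (X (- i%:Z)) (o (Y (N + i%:Z)) v).
    rewrite nordE; case: ifP => // _.
    rewrite (osc_rel fock (X _)) oddX XY.
    by rewrite scale0r addr0.
  rewrite GX GY (linZ (o (X _))) (osc_rel fock (Y' _)) Y'Y oddY oddY'.
  have -> : (n%:Z + - i%:Z + (N + i%:Z) + 1 == 0) = true by lia.
  rewrite (vacuum_annihilating vacuum_v (z := Y' _)); last first.
    by rewrite /annihilating oddY' modeY'; lia.
  rewrite linear0 scaler0 add0r rmorphN /= -pmulrn.
  case: i {le_in} => [|i] /=; last by lincomb.
  by rewrite oppr0 X0; lincomb.
transitivity (\sum_(i < n.+1)
    (sqrtC 2 * (i%:R + (if i == 0%N :> nat then a * b else 0))) *: v).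
  by apply: eq_bigr => i _; apply: term; rewrite -ltnS.
rewrite -scaler_suml -mulr_sumr big_split /= sum_first_integers; congr (_ * (_ + _) *: _).
by rewrite big_ord_recl /= big1 ?addr0.
Qed.

Local Notation c0 := (heis_form (1, 0) (fock_weight cL p r)).
Local Notation d0 := (heis_form (0, 1) (fock_weight cL p r)).

Lemma G_p_v (i : nat) : G n (o (opsip (N + i%:Z)) v) =
  (if i == 0%N then sqrtC 2 * (d0 / 2 - (cL - 3) / 12 * (n%:R + 1)) else 0) *: v.
Proof.
rewrite fockG_psip G_n_v linear0 oppr0 add0r.
have -> : n%:Z + (N + i%:Z) + 1 = i%:Z by lia.
case: i => [|i] /=; last first.
  by rewrite (vacuum_annihilating vacuum_v) //; lincomb.
have [_ _ _ ->] := vacuum_v.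
by lincomb.
Qed.

Lemma G_m_v (i : nat) : G n (o (opsim (N + i%:Z)) v) =
  (if i == 0%N then sqrtC 2 * (c0 / 2 + (n%:R + 1)) else 0) *: v.
Proof.
rewrite fockG_psim G_n_v linear0 oppr0 add0r.
have -> : n%:Z + (N + i%:Z) + 1 = i%:Z by lia.
case: i => [|i] /=; last first.
  by rewrite (vacuum_annihilating vacuum_v) //; lincomb.
have [_ _ -> _] := vacuum_v.
by lincomb.
Qed.

Lemma GG_v : G n (G N v) =
  (2 * h_pr cL p r + (n%:R ^+ 2 + n%:R) / 3 * cL) *: v.
Proof.
have [_ _ cv dv] := vacuum_v.
rewrite [G N v]fockG_quad (linZ (G n)) !(linD (G n)) (linN (G n)) !(linZ (G n)).
rewrite (G_quad_v (Y' := opsim) _ _ _ _ _ _ _ _ _ cv G_p_v) //; last exact: fockG_c.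
rewrite (G_quad_v (Y' := opsip) _ _ _ _ _ _ _ _ _ dv G_m_v) //; last exact: fockG_d.
have := G_p_v 0; have := G_m_v 0; rewrite !addr0 /= => -> ->.
have s2 : sqrtC 2 ^+ 2 = 2 :> K by exact: sqrtCK.
move: (sqrtC 2) s2 => s s2.
rewrite /h_pr /heis_form /fock_weight /=.
have -> : - (N + 1) = n%:Z by lia.
by lincomb; field : s2.
Qed.

End VacuumValue.

(** Only degree zero, n = - m - 1, requires a computation.  There one of G(m+1/2) and
    G(n+1/2) annihilates v, and the central term is symmetric in m and n. *)
Lemma fock_GG m n w : G m (G n w) = - G n (G m w) + 2 *: L (m + n + 1) w
  + ((m + n + 1 == 0)%:R * ((m ^+ 2 + m)%:~R / 3 * cL)) *: w.
Proof.
pose D w := G m (G n w) + G n (G m w) - 2 *: L (m + n + 1) w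
    - ((m + n + 1 == 0)%:R * ((m ^+ 2 + m)%:~R / 3 * cL)) *: w.
suff : D w = 0.
  rewrite /D => E; rewrite -[LHS]subr0 -E.
  by lincomb.
have linear_D : is_linear_map D.
  move=> a u x; rewrite /D !(linP (G n)) !(linP (G m)) (linP (L _)).
  by rewrite (linP (G n)); lincomb.
have [E|E] := eqVneq (m + n + 1) 0; last first.
  apply: (@graded_commutant_eq0 D false) (_ : (m + n + 1)%:~R != 0) _ w => //.
  - exact: fock_GG_commutant.
  - by rewrite intr_eq0.
  - move=> x; rewrite /D (negPf E) !mul0r !scale0r !subr0.
    rewrite !(linD (L 0)) !(linN (L 0)) (linZ (L 0)) !L0_G L0_L.
    rewrite (linD (G m)) (linN (G m)) (linZ (G m)) (linD (G n)) (linN (G n)) (linZ (G n)).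
    by lincomb.
apply: (@commutant_eq0 D false) => //; first exact: fock_GG_commutant.
have value (k : nat) (m1 := k%:Z) (n1 := - k%:Z - 1) :
    G m1 (G n1 v) + G n1 (G m1 v) =
    (2 * h_pr cL p r + (m1 ^+ 2 + m1)%:~R / 3 * cL) *: v.
  by rewrite GG_v G_n_v linear0 addr0 /m1 rmorphD rmorphXn /= -pmulrn.
rewrite /D E eqxx (L0_vacuum vacuum_v).
have -> : G m (G n v) + G n (G m v) =
    (2 * h_pr cL p r + (m ^+ 2 + m)%:~R / 3 * cL) *: v.
  case: m {D linear_D} E => k E.
    by have -> : n = - k%:Z - 1 by lia; apply: value.
  have -> : n = k%:Z by lia.
  have -> : Negz k = - k%:Z - 1 by rewrite NegzE; lia.
  rewrite addrC value; congr ((_ + _%:~R / _ * _) *: _).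
  by rewrite !expr2; lia.
by lincomb.
Qed.

(** The central term of {G(1/2), G(n-1/2)} vanishes for every n, because m^2 + m = 0 at
    m = 0; this reduces [L, L] to [L, G] and {G, G}. *)
Lemma fock_L_GG n w : L n w = 2^-1 *: (G 0 (G (n - 1) w) + G (n - 1) (G 0 w)).
Proof.
rewrite fock_GG; have -> : 0 + (n - 1) + 1 = n by lia.
by lincomb.
Qed.

Lemma fock_LL m n w : L m (L n w) = L n (L m w) + (m - n)%:~R *: L (m + n) w
  + ((m + n == 0)%:R * ((m ^+ 3 - m)%:~R / 12 * cL)) *: w.
Proof.
rewrite (fock_L_GG n w) (fock_L_GG n (L m w)) (linZ (L m)) (linD (L m)) !fock_LG.
rewrite (linD (G 0)) (linZ (G 0)) (linD (G (n - 1))) (linZ (G (n - 1))).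
rewrite !addr0 (fock_GG m (n - 1)) (fock_GG (m + (n - 1)) 0).
rewrite addr0; have -> : m + (n - 1) + 1 = m + n by lia.
case: eqP => e; lincomb; try by field.
have -> : n = - m by lia.
by field.
Qed.
End FockModule.

(** * The Fock module as a highest weight module *)

Section FockAction.
Variables (K : numClosedFieldType) (cL cLa p r : K) (F : lmodType K).
Variables (o : osc -> {linear F -> F}) (v : F).
Hypothesis fock : is_fock cL p r (fun x => o x) v.
Local Notation L := (fockL fock).
Local Notation G := (fockG fock).

Definition fock_rho (x : sh_basis) : {linear F -> F} :=
  match x with
  | shL n => L n
  | shA n => - cLa \*: o (oc n)
  | shG m => G m
  | shPsi m => - (sqrtC 2 * cLa) \*: o (opsim m)
  | shCL => cL \*: idfun
  | shCA => \0
  | shCLA => cLa \*: idfun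
  end.

Lemma fock_rhoE : fock_action cL cLa (fun x => o x) = fun x => fock_rho x.
Proof.
apply: funext => x; apply: funext => w; case: x => [n|n|n|n|||] //=.
  by rewrite (svalP (fockL_spec fock)).
by rewrite (svalP (fockG_spec fock)).
Qed.

Lemma fock_rho_bracket x y w :
  fock_rho x (fock_rho y w)
  - (-1) ^+ (sh_odd x && sh_odd y) *: fock_rho y (fock_rho x w)
  = \sum_(t <- sh_bracket K x y) t.1 *: fock_rho t.2 w.
Proof.
have s2 : sqrtC 2 ^+ 2 = 2 :> K by exact: sqrtCK.
case: x y => [m|m|m|m|||] [n|n|n|n|||];
  rewrite /= ?big_cons ?big_nil /= ?linear0 ?(linZ (L _)) ?(linZ (G _)) ?(linZ (o _))
    ?(addrC n m).
all: try by lincomb.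
- by rewrite (fock_LL fock m n); lincomb.
- by rewrite fockL_c; lincomb.
- by rewrite (fock_LG fock m n); lincomb.
- by rewrite fockL_psim; lincomb.
- by rewrite fockL_c ?(addrC n m); lincomb.
- by rewrite (osc_rel fock (oc m)) /=; lincomb.
- by rewrite fockG_c ?(addrC n m); lincomb.
- by rewrite (osc_rel fock (oc m)) /=; lincomb.
- by rewrite (fock_LG fock n m) ?(addrC n m); lincomb.
- by rewrite fockG_c; lincomb.
- by rewrite (fock_GG fock m n); lincomb.
- rewrite fockG_psim ?(addrC n m); move: (sqrtC 2) s2 => s s2.
  case: eqP => e; lincomb; try by field : s2.
  have {e}-> : n = - m - 1 by lia.
  by field : s2.
- by rewrite fockL_psim ?(addrC n m); lincomb.
- by rewrite (osc_rel fock (opsim m)) /=; lincomb.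
- rewrite fockG_psim ?(addrC n m); move: (sqrtC 2) s2 => s s2.
  case: eqP => e; lincomb; try by field : s2.
  have {e}-> : n = - m - 1 by lia.
  by field : s2.
- by rewrite (osc_rel fock (opsim m)) /=; lincomb.
Qed.

Theorem fock_highest_weight :
  hw_conditions cL cLa (h_pr cL p r) ((1 + p) * cLa) (fun x => fock_rho x) v.
Proof.
have vac := vacuum_v fock; split.
- split; last exact: fock_rho_bracket.
  by move=> x; apply: linear_is_linear_map.
- by split.
- case=> [n|n|n|n|||] //= n0.
  + exact: L_vacuum vac _ n0.
  + by rewrite (vacuum_annihilating vac) ?scaler0.
  + exact: G_vacuum vac _ n0.
  + by rewrite (vacuum_annihilating vac) ?scaler0.
- exact: L0_vacuum vac.
- case: vac => _ _ /= -> _; rewrite scalerA; congr (_ *: _).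
  by rewrite /heis_form /=; field.
Qed.
End FockAction.

(** * Nonvanishing in the Fock module *)

Section Nonzero.
Variables (K : numClosedFieldType) (cL cLa r : K) (p : nat) (F : lmodType K).
Variables (o : osc -> {linear F -> F}) (v : F).
Hypothesis fock : is_fock cL p%:R r (fun x => o x) v.
Hypotheses (cLa_neq0 : cLa != 0) (p_gt0 : (0 < p)%N) (p_even : ~~ odd p).
Local Notation rho := (fock_rho cLa fock).
Local Notation D := (o (od p%:Z)).

(** d(p) brackets nontrivially with alpha(-p) only, and the bracket is a scalar. *)
Definition d_shift (n : int) : {linear F -> F} :=
  - (2 * cLa * (p%:Z + n == 0)%:R) \*: idfun.

Lemma od_alpha n w :
  D (rho (shA n) w) = rho (shA n) (D w) - n%:~R *: d_shift n w.
Proof.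
rewrite /= (linZ D) (osc_rel fock (od p)) /= /heis_form /=.
case: eqP => e; last by lincomb.
have -> : n = - p%:Z by lia.
rewrite rmorphN /=; lincomb.
Qed.

Lemma od_schur_op t k w : D (schur_op cLa rho t k w) = schur_op cLa rho t k (D w)
  + \sum_(i < k) (2 / t * (i.+1 == p)%:R) *: schur_op cLa rho t (k - i.+1)%N w.
Proof.
rewrite (@schur_op_bracket _ cLa _ rho t D d_shift od_alpha); last first.
  by move=> m n u /=; rewrite !(linZ (o _)); lincomb.
congr (_ + _); apply: eq_bigr => i _; rewrite /d_shift /=.
have -> : (p%:Z - i.+1%:Z == 0) = (i.+1 == p) by lia.
rewrite scalerA invfM; congr (_ *: _).
by move: cLa_neq0 (i.+1 == p) (t^-1) => c0 b s; field.
Qed.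

Lemma od_schur_int_small t (k : int) w : k < p%:Z ->
  D (schur_int cLa rho t k w) = schur_int cLa rho t k (D w).
Proof.
case: k => k lt_kp; last by rewrite !schur_int_neg ?linear0.
rewrite -[LHS]/(D (schur_op cLa rho t k w)) od_schur_op big1 ?addr0 // => i _.
have /negPf -> : i.+1 != p by have := ltn_ord i; lia.
by rewrite mulr0 scale0r.
Qed.

(** y_j involves alpha(-k) for k <= j only. *)
Lemma od_dressed_psi (j : nat) w : (j < p)%N ->
  D (dressed_psi cLa rho p j w) = dressed_psi cLa rho p j (D w).
Proof.
move=> lt_jp; rewrite !dressed_psiE (lin_sum D); apply: eq_bigr => a _.
rewrite -od_schur_int_small; last by lia.
rewrite /= (linZ D) (osc_rel fock (od p)) /=; lincomb.
Qed.

Lemma od_u : D (u_vec cLa p rho v) = 2 *: v.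
Proof.
have Dv : D v = 0 by case: fock => _ [_ vd _ _] _ _ _; apply: vd.
rewrite /u_vec (linD D) [X in _ + X](lin_sum D) [X in _ + X]big1 => [|k _]; last first.
  have lt_kq := ltn_ord k; have pq := p_half p_even.
  rewrite (linZ D) od_dressed_psi; last by lia.
  by rewrite od_dressed_psi ?Dv ?linear0 ?scaler0 //; lia.
rewrite addr0 -[D _]/(D (schur_op cLa rho 1 p v)) od_schur_op Dv linear0 add0r.
have lt_pp : (p.-1 < p)%N by rewrite prednK.
rewrite (bigD1 (Ordinal lt_pp)) //= big1 => [|i].
  rewrite prednK // eqxx subnn addr0 divr1 mulr1.
  by congr (_ *: _); apply: (schur_int0 cLa rho 1 v).
rewrite -val_eqE /= => ne; have /negPf -> : i.+1 != p by lia.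
by rewrite mulr0 scale0r.
Qed.

Lemma fock_u_neq0 : u_vec cLa p rho v <> 0.
Proof.
move=> u0; have := od_u; rewrite u0 linear0 => /esym/eqP.
rewrite scaler_eq0 pnatr_eq0 /= => /eqP; by case: fock.
Qed.

End Nonzero.

(** * Cyclic submodules *)

Section CyclicSubmodule.
Variables (K : fieldType) (X : Type) (M : lmodType K).
Variables (rho : X -> {linear M -> M}) (v : M).

Definition in_cyclic : {pred M} := fun w => `[< forall P : set M,
  P v -> P 0 -> (forall (a : K) (u w : M), P u -> P w -> P (a *: u + w)) ->
  (forall x w, P w -> P (rho x w)) -> P w >].

Lemma in_cyclic_submod : GRing.submod_closed in_cyclic.
Proof.
split=> [|a u w /asboolP u_in /asboolP w_in]; apply/asboolP => P Pv P0 Plin Prho //.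
by apply: (Plin); [apply: u_in|apply: w_in].
Qed.

HB.instance Definition _ := GRing.isSubmodClosed.Build K M in_cyclic in_cyclic_submod.

Record cyclic : Type := Cyclic { cyclic_val : M; cyclic_valP : cyclic_val \in in_cyclic }.

HB.instance Definition _ := [isSub for cyclic_val].
HB.instance Definition _ := [Choice of cyclic by <:].
HB.instance Definition _ := [SubChoice_isSubLmodule of cyclic by <:].

Lemma cyclic_gen : v \in in_cyclic.
Proof. by apply/asboolP => P Pv. Qed.

Lemma cyclic_stable x w : w \in in_cyclic -> rho x w \in in_cyclic.
Proof.
move=> /asboolP w_in; apply/asboolP => P Pv P0 Plin Prho.
by apply: (Prho); apply: w_in.
Qed.

Definition cyclic_vec : cyclic := Cyclic cyclic_gen.
Definition cyclic_op (x : X) (w : cyclic) : cyclic :=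
  Cyclic (cyclic_stable x (cyclic_valP w)).

Lemma cyclic_op_linear x : is_linear_map (cyclic_op x).
Proof. by move=> a u w; apply: val_inj; rewrite /= linP. Qed.

Lemma cyclic_generated : generated_by cyclic_op cyclic_vec.
Proof.
move=> P Pv P0 Plin Pop w.
pose Q (u : M) := exists2 w' : cyclic, val w' = u & P w'.
have : Q (val w).
  have /asboolP in_w := cyclic_valP w; apply: (in_w Q).
  - by exists cyclic_vec.
  - by exists 0.
  - move=> a u1 u2 [w1 <- P1] [w2 <- P2].
    by exists (a *: w1 + w2) => //; apply: Plin.
  - by move=> x u [w1 <- P1]; exists (cyclic_op x w1) => //; apply: Pop.
by case=> w' /val_inj ->.
Qed.

End CyclicSubmodule.

(** * Existence of the Fock module *)

Section Update.
Variables (I : eqType) (A : Type).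
Definition upd (f : I -> A) (i : I) (a : A) : I -> A :=
  fun j => if j == i then a else f j.

Lemma updE f i a : upd f i a i = a.
Proof. by rewrite /upd eqxx. Qed.

Lemma upd_neq f i a j : j != i -> upd f i a j = f j.
Proof. by rewrite /upd => /negPf ->. Qed.

Lemma updC f i a j b : i != j -> upd (upd f i a) j b = upd (upd f j b) i a.
Proof.
move=> ij; apply: funext => l; rewrite /upd; case: (eqVneq l i) => [->|_] //.
by rewrite (negPf ij).
Qed.

Lemma upd_upd f i a b : upd (upd f i a) i b = upd f i b.
Proof. by apply: funext => l; rewrite /upd; case: eqP. Qed.

Lemma upd_self f i : upd f i (f i) = f.
Proof. by apply: funext => l; rewrite /upd; case: eqP => [->|]. Qed.
End Update.

Section Configurations.
Variable K : fieldType.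

(** Occupation numbers of the bosonic and of the fermionic creation modes. *)
Definition config : Type := ((nat * bool -> nat) * (nat -> bool))%type.
Definition cfun : lmodType K := (config -> K^o : lmodType K).

Implicit Types (f : cfun) (x : config).

(** Functions need not have finite support, so states are dual to the usual ones: the
    annihilator of a mode is evaluation at a configuration with one more particle,
    and the creator carries the occupation number as a factor, which makes it
    vanish at empty modes. *)
Definition lower (i : nat * bool) f : cfun :=
  fun x => f (upd x.1 i (x.1 i).+1, x.2).
Definition raise (i : nat * bool) f : cfun :=
  fun x => (x.1 i)%:R * f (upd x.1 i (x.1 i).-1, x.2) : K.

(** The Jordan-Wigner sign: it makes the flips of different modes anticommute. *)
Definition sgn (j : nat) (y : nat -> bool) : K := \prod_(i < j) (-1) ^+ (y i).

(** Flips the mode j, after testing its occupation by g: with g the identity this is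
    the creator of the mode, with g the negation its annihilator. *)
Definition flip (j : nat) (g : bool -> bool) f : cfun :=
  fun x => sgn j x.2 * (g (x.2 j))%:R * f (x.1, upd x.2 j (~~ x.2 j)) : K.

Lemma lower_linear i : is_linear_map (lower i).
Proof. by []. Qed.

Lemma raise_linear i : is_linear_map (raise i).
Proof.
move=> a f g; apply: funext => x.
rewrite -[LHS]/((x.1 i)%:R * (a * f _ + g _)).
rewrite -[RHS]/(a * ((x.1 i)%:R * f _) + (x.1 i)%:R * g _).
ring.
Qed.

Lemma flip_linear i h : is_linear_map (flip i h).
Proof.
move=> a f g; apply: funext => x.
rewrite -[LHS]/(sgn i x.2 * _ * (a * f _ + g _)).
rewrite -[RHS]/(a * (sgn i x.2 * _ * f _) + sgn i x.2 * _ * g _).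
ring.
Qed.

Lemma lower_raise i f : lower i (raise i f) = raise i (lower i f) + f.
Proof.
apply: funext => x; rewrite -[RHS]/(raise i (lower i f) x + f x) /lower /raise /=.
rewrite !updE /= !upd_upd upd_self; case: x => b y /=.
case E: (b i) => [|n] /=; first by rewrite mul0r add0r mul1r.
by rewrite -E upd_self E -[n.+2%:R]natr1 mulrDl mul1r.
Qed.

Lemma raise_lowerC i j f : i != j -> lower i (raise j f) = raise j (lower i f).
Proof.
move=> ij; apply: funext => x; rewrite /lower /raise /=.
by rewrite !upd_neq // 1?eq_sym // updC.
Qed.

Lemma lowerC i j f : lower i (lower j f) = lower j (lower i f).
Proof.
have [->//|ij] := eqVneq i j; apply: funext => x; rewrite /lower /=.
by rewrite !upd_neq // 1?eq_sym // updC.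
Qed.

Lemma raiseC i j f : raise i (raise j f) = raise j (raise i f).
Proof.
have [->//|ij] := eqVneq i j; apply: funext => x; rewrite /raise /=.
by rewrite !upd_neq // 1?eq_sym // updC // mulrCA.
Qed.

Lemma sgn_upd_ge i j y a : (i <= j)%N -> sgn i (upd y j a) = sgn i y.
Proof.
move=> le_ij; apply: eq_bigr => l _; rewrite upd_neq //.
by have := ltn_ord l; lia.
Qed.

Lemma sgn_flip_lt i j y : (i < j)%N -> sgn j (upd y i (~~ y i)) = - sgn j y.
Proof.
move=> lt_ij; rewrite /sgn (bigD1 (Ordinal lt_ij)) //= updE [in RHS](bigD1 (Ordinal lt_ij)) //=.
rewrite [in LHS](eq_bigr (fun l : 'I_j => (-1) ^+ y l)) => [|l]; last first.
  by rewrite -val_eqE /= => li; rewrite upd_neq.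
by case: (y i); rewrite ?expr0 ?expr1; ring.
Qed.

Lemma flip_anti i j g h f : i != j -> flip i g (flip j h f) = - flip j h (flip i g f).
Proof.
wlog lt_ij : i j g h / (i < j)%N => [W ij|_].
  case: (ltngtP i j) => [lt_ij|lt_ji|e]; first exact: W.
    by rewrite (W j i) ?opprK // eq_sym.
  by rewrite e eqxx in ij.
have ij : i != j by lia.
have ji : j != i by lia.
apply: funext => x; rewrite -[RHS]/(- (flip j h (flip i g f) x)) /flip /=.
rewrite (upd_neq _ _ ij) (upd_neq _ _ ji) (updC _ _ _ ij).
rewrite sgn_flip_lt // sgn_upd_ge ?(ltnW lt_ij) //; ring.
Qed.

Lemma flip_flip i g h f : flip i g (flip i h f) =
  fun x => (g (x.2 i) && h (~~ x.2 i))%:R * f x.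
Proof.
apply: funext => -[b y]; rewrite /flip /= updE upd_upd negbK upd_self.
rewrite sgn_upd_ge // -mulnb natrM.
have s2 : sgn i y * sgn i y = 1.
  rewrite -big_split big1 // => l _ /=.
  by rewrite -expr2 sqrr_sign.
ring : s2.
Qed.

End Configurations.

(** The modes of the two bosonic and the two fermionic fields are assembled from
    canonical pairs: the creation modes of each field pair with the annihilation
    modes of the conjugate one, whence [b] in one case and [~~ b] in the other.
    The factor 2 (k + 1) gives the normalisation <c, d> = 2. *)
Section OscillatorModes.
Variables (K : fieldType) (M : lmodType K).
Variables (up down : nat * bool -> {linear M -> M}).
Variables (fl : nat -> bool -> {linear M -> M}).
Hypothesis up_up : forall i j w, up i (up j w) = up j (up i w).
Hypothesis down_down : forall i j w, down i (down j w) = down j (down i w).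
Hypothesis down_up : forall i j w,
  down i (up j w) = up j (down i w) + (i == j)%:R *: w.
Hypothesis fl_fl : forall i j a b w,
  fl i a (fl j b w) = - fl j b (fl i a w) + ((i == j) && (a != b))%:R *: w.
Variable z : bool -> K.

Definition boson (b : bool) (n : int) : {linear M -> M} :=
  match n with
  | Negz k => up (k, b)
  | Posz 0 => z b \*: idfun
  | Posz k.+1 => (2 * k.+1%:R) \*: down (k, ~~ b)
  end.

Definition fermion (b : bool) (n : int) : {linear M -> M} :=
  match n with
  | Negz k => fl (k.*2 + b) true
  | Posz k => fl (k.*2 + ~~ b) false
  end.

Lemma boson_rel b c m n w : boson b m (boson c n w) =
  boson c n (boson b m w) + ((b != c)%:R * (m%:~R * 2 * (m + n == 0)%:R)) *: w.
Proof.
case: m => [[|m]|m]; case: n => [[|n]|n].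
- by rewrite /=; lincomb.
- by rewrite /= (linZ (down _)); lincomb.
- by rewrite /= (linZ (up _)); lincomb.
- by rewrite /= (linZ (down _)); lincomb.
- have -> : (m.+1%:Z + n.+1%:Z == 0) = false by lia.
  rewrite /= !(linZ (down _)) (down_down (m, _)).
  by lincomb.
- have -> : (m.+1%:Z + Negz n == 0) = (m == n) by lia.
  rewrite /= (linZ (up _)) down_up xpair_eqE.
  by case: (b) (c) (m == n) => [] [] []; lincomb.
- by rewrite /= (linZ (up _)); lincomb.
- have -> : (Negz m + n.+1%:Z == 0) = (m == n) by lia.
  rewrite /= (linZ (up _)) down_up xpair_eqE NegzE rmorphN /=.
  case: (eqVneq m n) => [<-|mn].
    by case: (b) (c) => [] []; lincomb.
  by lincomb.
- have -> : (Negz m + Negz n == 0) = false by lia.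
  by rewrite /= (up_up (m, _)); lincomb.
Qed.

Lemma double_bool (k l : nat) (b c : bool) :
  (k.*2 + b == l.*2 + c)%N = (k == l) && (b == c).
Proof. by case: b c => [] []; lia. Qed.

Lemma fermion_rel b c m n w : fermion b m (fermion c n w) =
  - fermion c n (fermion b m w) + ((b != c)%:R * (m + n + 1 == 0)%:R) *: w.
Proof.
case: m => m; case: n => n.
- have -> : (m%:Z + n%:Z + 1 == 0) = false by lia.
  by rewrite /= fl_fl andbF mulr0.
- have -> : (m%:Z + Negz n + 1 == 0) = (m == n) by lia.
  rewrite /= fl_fl double_bool.
  by case: (b) (c) (m == n) => [] [] []; rewrite /= ?mulr1 ?mulr0.
- have -> : (Negz m + n%:Z + 1 == 0) = (m == n) by lia.
  rewrite /= fl_fl double_bool.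
  by case: (b) (c) (m == n) => [] [] []; rewrite /= ?mulr1 ?mulr0.
- have -> : (Negz m + Negz n + 1 == 0) = false by lia.
  by rewrite /= fl_fl andbF mulr0.
Qed.

Definition modes (x : osc) : {linear M -> M} :=
  match x with
  | oc n => boson true n | od n => boson false n
  | opsip n => fermion true n | opsim n => fermion false n
  end.

Hypothesis up_fl : forall i j a w, up i (fl j a w) = fl j a (up i w).
Hypothesis down_fl : forall i j a w, down i (fl j a w) = fl j a (down i w).

Lemma boson_fermion b c m n w :
  boson b m (fermion c n w) = fermion c n (boson b m w).
Proof.
case: n => n; case: m => [[|m]|m] //=;
  by rewrite ?(linZ (fl _ _)) ?up_fl ?down_fl.
Qed.

Lemma modes_rel x y w :
  modes x (modes y w) - (-1) ^+ (osc_odd x && osc_odd y) *: modes y (modes x w)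
  = osc_bracket K x y *: w.
Proof.
by case: x y => [m|m|m|m] [n|n|n|n] /=;
  rewrite ?(boson_rel _ _ m n) ?(fermion_rel _ _ m n) -?boson_fermion /heis_form /=;
  lincomb.
Qed.

End OscillatorModes.

Section FockSpace.
Variables (K : fieldType) (cL p r : K).

Definition raising i : {linear cfun K -> cfun K} := lin_of (@raise_linear K i).
Definition lowering i : {linear cfun K -> cfun K} := lin_of (@lower_linear K i).
Definition flipping j (a : bool) : {linear cfun K -> cfun K} :=
  lin_of (@flip_linear K j (fun b => b == a)).

Lemma lowering_raising i j f :
  lowering i (raising j f) = raising j (lowering i f) + (i == j)%:R *: f.
Proof.
have [<-|ij] := eqVneq i j; first by rewrite scale1r; exact: lower_raise.
by rewrite scale0r addr0; exact: raise_lowerC.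
Qed.

Lemma flipping_anti i j a b f : flipping i a (flipping j b f) =
  - flipping j b (flipping i a f) + ((i == j) && (a != b))%:R *: f.
Proof.
have [<-|ij] := eqVneq i j; last by rewrite scale0r addr0; exact: flip_anti.
rewrite -[LHS]/(flip _ _ (flip _ _ f)) -[X in - X]/(flip _ _ (flip _ _ f)).
rewrite !flip_flip; apply: funext => x.
rewrite -[RHS]/(- (_ * f x) + _ * f x) -mulNr -mulrDl; congr (_ * _).
by case: a b (x.2 i) => [] [] []; rewrite /= ?mulr1n ?mulr0n; ring.
Qed.

Definition fock_modes : osc -> {linear cfun K -> cfun K} :=
  modes raising lowering flipping (fun b => if b
    then heis_form (1, 0) (fock_weight cL p r)
    else heis_form (0, 1) (fock_weight cL p r)).

Definition empty_config : config := (fun=> 0%N, fun=> false).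
Definition fock_vacuum : cfun K := fun x => (`[< x = empty_config >]%:R : K).

Lemma lowering_vacuum i : lowering i fock_vacuum = 0.
Proof.
apply: funext => x; rewrite -[LHS]/(fock_vacuum (upd x.1 i (x.1 i).+1, x.2)).
rewrite /fock_vacuum; case: asboolP => // -[/(congr1 (fun b => b i))].
by rewrite updE.
Qed.

Lemma flipping_vacuum j : flipping j false fock_vacuum = 0.
Proof.
apply: funext => x.
rewrite -[LHS]/(_ * (x.2 j == false)%:R * fock_vacuum (x.1, upd x.2 j (~~ x.2 j))).
rewrite /fock_vacuum; case: asboolP => [[_ /(congr1 (fun b => b j))]|_].
  by rewrite updE => /negbFE ->; rewrite mulr0 mul0r.
by rewrite mulr0.
Qed.

Lemma fock_exists : exists (F : lmodType K) (o : osc -> {linear F -> F}) (v : F),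
  is_fock cL p r (fun x => o x) v.
Proof.
exists (cyclic fock_modes fock_vacuum).
exists (fun x => lin_of (cyclic_op_linear (rho := fock_modes) (v := fock_vacuum) x)).
exists (cyclic_vec fock_modes fock_vacuum).
split.
- split=> [x|x y w]; first exact: cyclic_op_linear.
  apply: val_inj; rewrite /=; apply: modes_rel.
  + exact: raiseC.
  + exact: lowerC.
  + exact: lowering_raising.
  + exact: flipping_anti.
  + by move=> i j a f; apply: funext => u; apply: mulrCA.
  + by [].
- split.
  + case=> [[|n]|n] // _; apply: val_inj.
    rewrite -[LHS]/((2 * n.+1%:R) *: lowering (n, false) fock_vacuum).
    by rewrite lowering_vacuum scaler0.
  + case=> [[|n]|n] // _; apply: val_inj.
    rewrite -[LHS]/((2 * n.+1%:R) *: lowering (n, true) fock_vacuum).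
    by rewrite lowering_vacuum scaler0.
  + by case=> // n _; apply: val_inj; exact: flipping_vacuum.
  + by case=> // n _; apply: val_inj; exact: flipping_vacuum.
- by split; apply: val_inj.
- move=> /(congr1 (fun w => val w empty_config)) /eqP.
  by rewrite /= /fock_vacuum; case: asboolP => // _; rewrite oner_eq0.
- exact: cyclic_generated.
Qed.

End FockSpace.

(** * The singular vector *)

Theorem theorem4p5 (R : realType) (cL cLa r : R[i]) (p : nat) :
  cLa != 0 -> (0 < p)%N -> ~~ odd p ->
  [/\ h_pr cL p%:R r + p%:R = h_pr cL p%:R (r - 1),
      forall (V : lmodType R[i]) (rho : sh_basis -> V -> V) (v : V),
        is_verma_pr cL cLa p%:R r rho v ->
        singular rho (u_pr cLa rho p v) /\
        conformal_weight rho (h_pr cL p%:R r + p%:R) (u_pr cLa rho p v)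
    & forall (F : lmodType R[i]) (o : osc -> F -> F) (v : F),
        is_fock cL p%:R r o v ->
        singular (fock_action cL cLa o) (u_pr cLa (fock_action cL cLa o) p v) /\
        conformal_weight (fock_action cL cLa o) (h_pr cL p%:R r + p%:R)
          (u_pr cLa (fock_action cL cLa o) p v)].
Proof.
move=> cLa0 p0 p_even; split=> [|V rho v verma|F o v fock].
- by rewrite /h_pr; ring.
- have [hw _ universal] := verma.
  have [[lin_rho _] _ _ _ _] := hw.
  pose rl x := lin_of (lin_rho x).
  have {}hw : hw_conditions cL cLa (h_pr cL p%:R r) ((1 + p%:R) * cLa)
    (fun x => rl x) v by exact: hw.
  have -> : u_pr cLa rho p v = u_vec cLa p rl v by apply: u_pr_vec hw p_even.
  split; last exact: (u_degree cLa0 hw p_even).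
  split; last by move=> x x_pos; apply: (u_annihilated cLa0 hw p_even).
  have [F [o [w fock]]] := fock_exists cL p%:R r.
  have [f [lin_f f_rho f_v]] := universal _ _ _ (fock_highest_weight cLa fock).
  move=> /(congr1 f).
  have := u_vec_map cLa p (rho := rl) (sigma := fock_rho cLa fock)
    (T := lin_of lin_f) f_rho v.
  rewrite /= f_v => -> /esym.
  have -> : f 0 = 0 by exact: (linear0 (lin_of lin_f)).
  by move=> /esym; apply: fock_u_neq0.
- have [[lin_o _] _ _ _ _] := fock.
  pose ol x := lin_of (lin_o x).
  have {}fock : is_fock cL p%:R r (fun x => ol x) v by exact: fock.
  have := fock_highest_weight cLa fock => hw.
  have -> : fock_action cL cLa o = (fun x => fock_rho cLa fock x).
    exact: (fock_rhoE cLa fock).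
  rewrite (u_pr_vec cLa0 hw p_even).
  split; last exact: (u_degree cLa0 hw p_even).
  split; first exact: fock_u_neq0.
  by move=> x x_pos; apply: (u_annihilated cLa0 hw p_even).
Qed.
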